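(* Let $G$ and $H$ be Lie groups, let $\Theta:G\to\mathrm{Aut}(H)$ be an action of $G$ on $H$, let $D:G\to H$ be a crossed homomorphism with respect to $\Theta$, and let $\mathcal D:G\times\mathbb R\to H$ be a deformation of $D$, with $D_s=\mathcal D(\cdot,s)$ and $$\hat D_s(a)=(R_{D_s(a)^{-1}})_{*D_s(a)}\frac{d}{dt}\Big|_{t=0}D_{t+s}(a)\in\mathfrak h,\qquad a\in G,\ s\in\mathbb R,$$ where $\mathfrak h$ is the Lie algebra of $H$ (so that $\hat D_s\in Z^1(D_s)$). 1. If $\mathcal D$ is trivial on $\mathbb R$, then the cohomology classes $[\hat D_s]\in\mathcal H^1(D_s)$ vanish smoothly on $\mathbb R$. 2. Conversely, if the cohomology classes $[\hat D_s]$ vanish smoothly on $\mathbb R$, then $\mathcal D$ is a pointwise trivial deformation of $D$.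
   Context: An action $\Theta:G\to\mathrm{Aut}(H)$ is a (smooth) action of $G$ on $H$ by Lie group automorphisms. A crossed homomorphism with respect to $\Theta$ is a smooth map $D:G\to H$ with $D(ab)=D(a)\cdot(\Theta(a)D(b))$ for all $a,b\in G$. $R_h$ denotes right multiplication by $h$ on $H$, and $(R_h)_{*x}$ its tangent map at $x$. A deformation of $D$ is a smooth map $\mathcal D:G\times\mathbb R\to H$ such that $\mathcal D(\cdot,0)=D$ and $\mathcal D(\cdot,t)$ is a crossed homomorphism with respect to $\Theta$ for every $t\in\mathbb R$. Trivial: $\mathcal D$ is trivial on an interval $I$ (either $I=(-\varepsilon,\varepsilon)$ or $I=\mathbb R$) if there is a smooth map $\tau:I\to H$ with $\tau(0)=e_H$ and $D_t(a)=\tau(t)\,D(a)\,\Theta(a)(\tau(t)^{-1})$ for all $a\in G$, $t\in I$. Pointwise trivial: $\mathcal D$ is pointwise trivial if there are an interval $I=(-\varepsilon,\varepsilon)$ and a smooth map $\tau:I\to H$ with $\tau(0)=e_H$ such that for each $a\in G$ there is an interval $I_a=(-\varepsilon_a,\varepsilon_a)\subset I$ with $D_t(a)=\tau(t)\,D(a)\,\Theta(a)(\tau(t)^{-1})$ for all $t\in I_a$. Cohomology of a crossed homomorphism $D$: with $\tilde\Theta(a)=\Theta(a)_{*e_H}$, the formula $\Theta_D(a)u=\mathrm{Ad}_{D(a)}\tilde\Theta(a)u$ defines a representation of $G$ on $\mathfrak h$, and $\mathcal H^k(D)$ (cocycles $Z^k(D)$, differential $\mathrm d^D$) is the smooth group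 cohomology of $G$ with coefficients in $(\mathfrak h,\Theta_D)$, with $0$-cochains $\mathfrak h$. In low degrees, $\mathrm d^Du(a)=\Theta_D(a)u-u$ for $u\in\mathfrak h$, and $\mathrm d^D\alpha(a,b)=\Theta_D(a)\alpha(b)-\alpha(ab)+\alpha(a)$ for smooth $\alpha:G\to\mathfrak h$. Vanish smoothly: for cocycles $c_s\in Z^1(D_s)$, the classes $[c_s]\in\mathcal H^1(D_s)$ vanish smoothly on $\mathbb R$ if there is a smooth map $\kappa:\mathbb R\to\mathfrak h$ with $\mathrm d^{D_s}(\kappa(s))=c_s$ for all $s\in\mathbb R$. *)

(* Defs.v *)
From HB Require Import structures.
From mathcomp Require Import all_boot all_order all_algebra.
From mathcomp Require Import all_classical all_reals all_analysis.

Set Implicit Arguments.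
Unset Strict Implicit.
Unset Printing Implicit Defensive.

Import Order.TTheory GRing.Theory Num.Theory.
Import numFieldNormedType.Exports.

Local Open Scope classical_set_scope.
Local Open Scope ring_scope.

(* [Ck k U f] is meant for open [U] and finite-dimensional [V]: there, the
   derivative [x |-> 'd f x] with values in the linear maps is of class C^k iff
   [x |-> 'd f x v] is, for every vector [v]. *)
Fixpoint Ck (R : realType) (V W : normedModType R) (k : nat) (U : set V)
    (f : V -> W) {struct k} : Prop :=
  match k with
  | 0 => forall x, U x -> {for x, continuous f}
  | k'.+1 => (forall x, U x -> differentiable f x) /\
             (forall v : V, Ck k' U (fun x => 'd f x v))
  end.

Definition Csmooth (R : realType) (V W : normedModType R) (U : set V)
    (f : V -> W) : Prop :=
  forall k, Ck k U f.

(* Only the values of [chart_map] on [chart_dom], and those of [chart_inv] on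
   the image of [chart_dom], are meaningful. *)
Record chart (R : realType) (E : normedModType R) (M : topologicalType) := Chart {
  chart_dom : set M;
  chart_map : M -> E;
  chart_inv : E -> M
}.

Definition is_chart (R : realType) (E : normedModType R) (M : topologicalType)
    (c : chart E M) : Prop :=
  [/\ open (chart_dom c),
      open (chart_map c @` chart_dom c),
      (forall x, chart_dom c x -> chart_inv c (chart_map c x) = x),
      (forall x, chart_dom c x -> {for x, continuous (chart_map c)}) &
      (forall u, (chart_map c @` chart_dom c) u ->
         {for u, continuous (chart_inv c)})].

(* An atlas together with a preferred chart around each point. The preferred
   charts are used only to coordinatize the tangent spaces: see [tangent]. *)
Record atlas (R : realType) (E : normedModType R) (M : topologicalType) := Atlas {
  in_atlas : set (chart E M);
  chart_at : M -> chart E M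
}.

Definition is_manifold (R : realType) (E : normedModType R)
    (M : topologicalType) (A : atlas E M) : Prop :=
  [/\ hausdorff_space M,
      @second_countable M,
      (forall c, in_atlas A c -> is_chart c),
      (forall x, in_atlas A (chart_at A x) /\ chart_dom (chart_at A x) x) &
      (forall c d, in_atlas A c -> in_atlas A d ->
         Csmooth (chart_map c @` (chart_dom c `&` chart_dom d))
                 (chart_map d \o chart_inv c))].

Definition model_atlas (R : realType) (E : normedModType R) : atlas E E :=
  let c := Chart setT id id in Atlas [set c] (fun=> c).

Definition prod_chart (R : realType) (E F : normedModType R)
    (M N : topologicalType) (c : chart E M) (d : chart F N) :
    chart (E * F)%type (M * N)%type :=
  Chart (chart_dom c `*` chart_dom d)
        (fun p => (chart_map c p.1, chart_map d p.2))
        (fun u => (chart_inv c u.1, chart_inv d u.2)).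

Definition prod_atlas (R : realType) (E F : normedModType R)
    (M N : topologicalType) (A : atlas E M) (B : atlas F N) :
    atlas (E * F)%type (M * N)%type :=
  Atlas [set e | exists c d,
           [/\ in_atlas A c, in_atlas B d & e = prod_chart c d]]
        (fun p => prod_chart (chart_at A p.1) (chart_at B p.2)).

(* [f] is smooth on the open submanifold [U] of [M]; the values of [f] outside
   [U] are irrelevant. *)
Definition smooth_on (R : realType) (E F : normedModType R)
    (M N : topologicalType) (A : atlas E M) (B : atlas F N)
    (U : set M) (f : M -> N) : Prop :=
  (forall x, U x -> {for x, continuous f}) /\
  (forall c d, in_atlas A c -> in_atlas B d ->
     Csmooth (chart_map c @` (chart_dom c `&` U `&` f @^-1` chart_dom d))
             (chart_map d \o f \o chart_inv c)).

(* The tangent space at [x] of a manifold modelled on [E] is the vector space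
   [E], a tangent vector being given by its coordinates in the preferred chart
   at [x]. Accordingly, the tangent map of [f] at [x], from the tangent space
   at [x] to the one at [f x], is the differential of the expression of [f] in
   the preferred charts at [x] and at [f x]. *)
Definition tangent (R : realType) (E F : normedModType R)
    (M N : topologicalType) (A : atlas E M) (B : atlas F N)
    (f : M -> N) (x : M) : E -> F :=
  'd (chart_map (chart_at B (f x)) \o f \o chart_inv (chart_at A x))
     (chart_map (chart_at A x) x).

Definition velocity (R : realType) (F : normedModType R) (N : topologicalType)
    (B : atlas F N) (gamma : R^o -> N) (t : R) : F :=
  tangent (model_atlas (R^o)) B gamma t 1.

HB.mixin Record isLieGroup (R : realType) G of Group G & Topological G := {
  lie_dim : nat;
  lie_atlas : atlas 'rV[R]_lie_dim G;
  lie_manifold : is_manifold lie_atlas;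
  lie_mul_smooth : smooth_on (prod_atlas lie_atlas lie_atlas) lie_atlas
    [set: G * G] (fun p : G * G => (p.1 * p.2)%g);
  lie_inv_smooth : smooth_on lie_atlas lie_atlas [set: G] (fun x : G => (x^-1)%g)
}.

#[short(type="lieGroupType")]
HB.structure Definition LieGroup (R : realType) :=
  {G of isLieGroup R G & Group G & Topological G}.

Arguments lie_dim {R} s.
Arguments lie_atlas {R} s.

(* The underlying vector space of the Lie algebra: the tangent space at 1. *)
Definition lie_alg (R : realType) (G : lieGroupType R) : normedModType R :=
  'rV[R]_(lie_dim G).

Section CrossedHomomorphisms.
Variables (R : realType) (G H : lieGroupType R).

Definition lie_automorphism (f : H -> H) : Prop :=
  {morph f : x y / (x * y)%g} /\
  exists g : H -> H,
    [/\ cancel f g, cancel g f,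
        smooth_on (lie_atlas H) (lie_atlas H) setT f &
        smooth_on (lie_atlas H) (lie_atlas H) setT g].

Definition lie_action (Theta : G -> H -> H) : Prop :=
  [/\ (forall a, lie_automorphism (Theta a)),
      (forall x, Theta 1%g x = x),
      (forall a b x, Theta (a * b)%g x = Theta a (Theta b x)) &
      smooth_on (prod_atlas (lie_atlas G) (lie_atlas H)) (lie_atlas H)
        [set: G * H] (fun p : G * H => Theta p.1 p.2)].

Variable Theta : G -> H -> H.

Definition crossed_hom (D : G -> H) : Prop :=
  smooth_on (lie_atlas G) (lie_atlas H) setT D /\
  forall a b, D (a * b)%g = (D a * Theta a (D b))%g.

Definition at_time (DD : G * R^o -> H) (t : R) : G -> H := fun a => DD (a, t).

Definition deformation (D : G -> H) (DD : G * R^o -> H) : Prop :=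
  [/\ smooth_on (prod_atlas (lie_atlas G) (model_atlas (R^o))) (lie_atlas H)
        [set: G * R^o] DD,
      at_time DD 0 = D &
      forall t : R, crossed_hom (at_time DD t)].

Definition trivial_on (D : G -> H) (DD : G * R^o -> H) (I : set R) : Prop :=
  exists tau : R^o -> H,
    [/\ smooth_on (model_atlas (R^o)) (lie_atlas H) I tau,
        tau 0 = 1%g &
        forall a t, I t ->
          at_time DD t a = (tau t * D a * Theta a (tau t)^-1)%g].

Definition pointwise_trivial (D : G -> H) (DD : G * R^o -> H) : Prop :=
  exists (eps : R) (tau : R^o -> H),
    [/\ 0 < eps,
        smooth_on (model_atlas (R^o)) (lie_atlas H) `]- eps, eps[%classic tau,
        tau 0 = 1%g &
        forall a, exists eps_a : R,
          0 < eps_a <= eps /\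
          forall t : R, `]- eps_a, eps_a[%classic t ->
            at_time DD t a = (tau t * D a * Theta a (tau t)^-1)%g].

(* The targets of the tangent maps in [Ad], [tTheta] and [hatD] are the tangent
   spaces at [h * 1 * h^-1], [Theta a 1] and [h * h^-1]; these points are equal
   to [1], so that the values are in [lie_alg H]. *)
Definition Ad (h : H) : lie_alg H -> lie_alg H :=
  tangent (lie_atlas H) (lie_atlas H) (fun x : H => (h * x * h^-1)%g) 1%g.

Definition tTheta (a : G) : lie_alg H -> lie_alg H :=
  tangent (lie_atlas H) (lie_atlas H) (Theta a) 1%g.

Definition Theta_rep (D : G -> H) (a : G) (u : lie_alg H) : lie_alg H :=
  Ad (D a) (tTheta a u).

Definition d0 (D : G -> H) (u : lie_alg H) : G -> lie_alg H :=
  fun a => Theta_rep D a u - u.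

Definition d1 (D : G -> H) (alpha : G -> lie_alg H) : G -> G -> lie_alg H :=
  fun a b => Theta_rep D a (alpha b) - alpha (a * b)%g + alpha a.

Definition cocycle1 (D : G -> H) (alpha : G -> lie_alg H) : Prop :=
  smooth_on (lie_atlas G) (model_atlas (lie_alg H)) setT alpha /\
  forall a b, d1 D alpha a b = 0.

Definition vanish_smoothly (Ds : R -> G -> H) (c : R -> G -> lie_alg H) : Prop :=
  exists kappa : R^o -> lie_alg H,
    smooth_on (model_atlas (R^o)) (model_atlas (lie_alg H)) setT kappa /\
    forall s, d0 (Ds s) (kappa s) = c s.

Definition hatD (DD : G * R^o -> H) (s : R) (a : G) : lie_alg H :=
  let h := at_time DD s a in
  tangent (lie_atlas H) (lie_atlas H) (fun x : H => (x * h^-1)%g) h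
    (velocity (lie_atlas H) (fun t : R^o => at_time DD (t + s) a) 0).

End CrossedHomomorphisms.

(* Main.v *)
From HB Require Import structures.
Require Import Defs.
From mathcomp Require Import all_boot all_order all_algebra.
From mathcomp Require Import all_classical all_reals all_analysis.
From mathcomp Require Import ring lra.

Set Implicit Arguments.
Unset Strict Implicit.
Unset Printing Implicit Defensive.

Import Order.TTheory GRing.Theory Num.Theory.
Import numFieldNormedType.Exports.

Local Open Scope classical_set_scope.
Local Open Scope ring_scope.

(** Write the right logarithmic derivative of a curve [g] in [H] at time [s] as
    the velocity at [s] of [t |-> g t * (g s)^-1], a curve through the identity.
    The vector [hatD DD s a] is that of the curve [t |-> DD (a, t)] ([hatDE]).
    Since the group law differentiates at [(1, 1)] to the addition of [lie_alg H]
    ([velocity_mulg1]), every factorization of a quotient curve into curves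
    through the identity gives a linear identity between logarithmic derivatives.
    Three factorizations prove the theorem; let [v] be the logarithmic derivative
    at [s] of a curve [tau] in [H].

    - The equation [D(ab) = D(a) Theta_a(D(b))] at the times [t] and [s] gives the
      cocycle identity for [hatD] ([hatD_mul]).
    - If [DD (a, t) = tau t * D a * Theta a (tau t)^-1], then
      [hatD DD s a = v - Theta_rep a v] ([hatD_gauge]), so that [- v] is a primitive
      of [hatD DD s]. It is smooth in [s], because the velocity at the identity
      of a smooth family of curves is smooth in the parameters
      ([msmooth_velocity]), which also yields the smoothness of [hatD DD s].
    - Conversely, given [kappa], choose [tau] near [0] with [tau 0 = 1] and
      logarithmic derivative [- kappa] ([right_ode]). Then the curve
      [t |-> (tau t)^-1 * DD (a, t) * Theta a (tau t)] has velocity zero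
      ([velocity_ungauge]), hence is constant near [0] in a chart around its value
      [D a] ([velocity0_locally_cst]). How long it stays in that chart depends on
      [a].

    The curve [tau] comes from the local existence of smooth solutions of
    [x' = f (t, x)] for a smooth [f] ([ode_local]), applied in the preferred chart
    at the identity. This is Picard iteration on a truncated and rescaled right-hand
    side ([picard]), followed by a bootstrap for the smoothness ([ode_smooth]).

    Charts are handled by the pointwise predicate [msmooth] and the chain rule
    [tangent_comp]: as the tangent map is written in the preferred charts at the
    source and target points, the charts of the intermediate point cancel. *)

(** * Maps of class C^k between normed modules *)

Section Calculus.
Context {R : realType}.
Implicit Types (U V W : normedModType R).

(** The difference [g - f] vanishes near [x], so that it is differentiable there
    with derivative zero. *)
Lemma near_eq_is_diff V W (f g : V -> W) (df : V -> W) x :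
  {near x, f =1 g} -> is_diff x f df -> is_diff x g df.
Proof.
move=> fg dfx.
suff h0 : is_diff x (g \- f) (0 : V -> W).
  have -> : g = f + (g \- f) by apply/funext => y /=; rewrite !fctE subrKC.
  by rewrite -[df]addr0; exact: is_diffD.
have nf : {near 0, ((g \- f) \o shift x) =1 cst 0}.
  rewrite (near_shift x 0)/=.
  near=> y; rewrite /= sub0r subrK; apply/eqP; rewrite subr_eq0; apply/eqP/esym.
  by near: y.
have e0 : (g \- f) \o shift x = cst ((g \- f) x) + (0 : V -> W) +o_ 0 id.
  apply/eqaddoP => e e0; near=> y.
  have hy : ((g \- f) \o shift x) y = 0 by near: y.
  have hx : (g \- f) x = 0.
    by have := nbhs_singleton nf; rewrite /= add0r.
  rewrite [X in `|X|](_ : _ = ((g \- f) \o shift x) y - ((g \- f) x + 0))//.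
  by rewrite hy hx addr0 subrr normr0 mulr_ge0// ltW.
have d0 : 'd (g \- f) x = (0 : V -> W) :> (V -> W).
  by apply/diff_unique => //; exact: cst_continuous.
apply: DiffDef => //.
apply/diff_locallyP; split; rewrite d0 //; exact: cst_continuous.
Unshelve. all: by end_near. Qed.

(** [Ck] quantifies over the points of [A] at every level, so that it can be
    checked point by point; this is what makes smoothness a local matter. *)
Lemma Ck_pointwise V W k (A : set V) (f : V -> W) :
  Ck k A f <-> forall x, A x -> Ck k [set x] f.
Proof.
elim: k A f => [|k IH] A f /=.
  by split=> [h x Ax y -> |h x Ax]; [exact: h|exact: (h x Ax x)].
split=> [[h1 h2] x Ax|h].
  split=> [y ->|v]; first exact: h1.
  by have /IH := h2 v; apply.
split=> [x Ax|v]; first by have [+ _] := h x Ax; exact.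
by apply/IH => x Ax; have [_] := h x Ax; exact.
Qed.

Lemma sub_Ck V W k (A B : set V) (f : V -> W) :
  A `<=` B -> Ck k B f -> Ck k A f.
Proof. by move=> AB /Ck_pointwise h; apply/Ck_pointwise => x /AB /h. Qed.

Lemma eq_Ck V W k (A : set V) (f g : V -> W) : open A ->
  (forall x, A x -> f x = g x) -> Ck k A f -> Ck k A g.
Proof.
move=> oA; elim: k f g => [|k IH] f g fg /=.
  move=> cf x Ax; have : f @ x --> f x by exact: cf.
  rewrite (fg _ Ax) => h; apply: cvg_trans h; apply: near_eq_cvg.
  by near=> y; apply: fg; near: y; exact: open_nbhs_nbhs.
have nfg x : A x -> {near x, f =1 g}.
  by move=> Ax; near=> y; apply: fg; near: y; exact: open_nbhs_nbhs.
move=> [df dfk]; split=> [x Ax|v].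
  by have /differentiableP/(near_eq_is_diff (nfg x Ax)) [] := df x Ax.
apply: IH (dfk v) => x Ax.
by have /differentiableP/(near_eq_is_diff (nfg x Ax)) [_ ->] := df x Ax.
Unshelve. all: by end_near. Qed.

Lemma Ck_continuous V W k (A : set V) (f : V -> W) :
  Ck k A f -> forall x, A x -> {for x, continuous f}.
Proof.
by case: k => //= k [df _] x Ax; exact/differentiable_continuous/df.
Qed.

Lemma Ck_cst V W k (A : set V) (c : W) : Ck k A (cst c).
Proof.
elim: k c => [|k IH] c /=; first by move=> x _; exact: cst_continuous.
split=> [x _|v]; first exact: differentiable_cst.
rewrite (_ : (fun x => _) = cst 0); first exact: IH.
by apply/funext => x; rewrite diff_cst.
Qed.

Lemma CkD V W k (A : set V) (f g : V -> W) : open A ->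
  Ck k A f -> Ck k A g -> Ck k A (fun x => f x + g x).
Proof.
move=> oA; elim: k f g => [|k IH] f g /=.
  by move=> cf cg x Ax; exact: (continuousD (cf x Ax) (cg x Ax)).
move=> [df dfk] [dg dgk].
have dD x : A x -> is_diff x (fun x => f x + g x) (fun v => 'd f x v + 'd g x v).
  by move=> Ax; apply: is_diffD; apply: differentiableP; [exact: df|exact: dg].
split=> [x Ax|v]; first by have [] := dD x Ax.
apply: (@eq_Ck _ _ _ _ (fun x => 'd f x v + 'd g x v)) => //.
  by move=> x Ax; have [_ ->] := dD x Ax.
exact: (IH (fun x => 'd f x v) (fun x => 'd g x v)).
Qed.

Lemma Ck_lin V W k (A : set V) (l : {linear V -> W}) :
  continuous l -> Ck k A l.
Proof.
move=> cl; case: k => [|k] /=; first by move=> x _; exact: cl.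
split=> [x _|v]; first exact: linear_differentiable.
rewrite (_ : (fun x => _) = cst (l v)); first exact: Ck_cst.
by apply/funext => x; rewrite diff_lin.
Qed.

Lemma Ck_leS V W k (A : set V) (f : V -> W) : Ck k.+1 A f -> Ck k A f.
Proof.
elim: k f => [|k IH] f; first exact: Ck_continuous.
by move=> [df dfk]; split=> // v; apply: IH; exact: dfk.
Qed.

(** The scaling operation is a continuous bilinear map, and [f] and [a] are its
    two arguments. *)
Lemma is_diff_scale V W (a : V -> R^o) (f : V -> W) da df x :
  is_diff x a da -> is_diff x f df ->
  is_diff x (fun y => a y *: f y) (fun v => a x *: df v + da v *: f x).
Proof.
move=> dax dfx.
pose b (r : R^o) (w : W) := r *: w.
have blin : bilinear_for
    (GRing.Scale.Law.clone _ _ *:%R _) (GRing.Scale.Law.clone _ _ *:%R _) b.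
  split=> [w k r s|r k w w'] /=; first by rewrite /b scalerDl scalerA.
  by rewrite /b scalerDr !scalerA mulrC.
pose bM := bilinear_isBilinear.Build _ _ _ _ _ _ b blin.
pose bL : {bilinear R^o -> W -> W} := HB.pack b bM.
have cb : continuous (fun p : R^o * W => bL p.1 p.2) by exact: scale_continuous.
have db : is_diff (a x, f x) (fun p : R^o * W => bL p.1 p.2)
    (fun q => bL (a x) q.2 + bL q.1 (f x)).
  by apply: DiffDef; [exact: differentiable_bilin|exact: diff_bilin].
exact: (is_diff_comp (is_diff_pair dax dfx) db).
Qed.

Lemma CkZ V W k (A : set V) (a : V -> R^o) (f : V -> W) : open A ->
  Ck k A a -> Ck k A f -> Ck k A (fun x => a x *: f x).
Proof.
move=> oA; elim: k a f => [|k IH] a f.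
  by move=> ca cf x Ax; exact: (continuousZ (ca x Ax) (cf x Ax)).
move=> Ca Cf; have [da dak] := Ca; have [df dfk] := Cf.
have dZ x : A x -> is_diff x (fun x => a x *: f x)
    (fun v => a x *: 'd f x v + 'd a x v *: f x).
  by move=> Ax; apply: is_diff_scale; apply: differentiableP; [exact: da|exact: df].
split=> [x Ax|v]; first by have [] := dZ x Ax.
apply: (@eq_Ck _ _ _ _ (fun x => a x *: 'd f x v + 'd a x v *: f x)) => //.
  by move=> x Ax; have [_ ->] := dZ x Ax.
by apply: CkD => //; apply: IH; [exact: Ck_leS|exact: dfk|exact: dak|exact: Ck_leS].
Qed.

Lemma Ck_sum V W k (A : set V) (I : Type) (r : seq I) (f : I -> V -> W) :
  open A -> (forall i, Ck k A (f i)) -> Ck k A (fun x => \sum_(i <- r) f i x).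
Proof.
move=> oA Cf; elim: r => [|i r IH].
  rewrite (_ : (fun x => _) = cst 0); first exact: Ck_cst.
  by apply/funext => x; rewrite big_nil.
rewrite (_ : (fun x => _) = (fun x => f i x + \sum_(j <- r) f j x)).
  exact: CkD.
by apply/funext => x; rewrite big_cons.
Qed.

Lemma Ck_linear_comp U V W k (A : set U) (f : U -> V) (l : {linear V -> W}) : open A ->
  continuous l -> Ck k A f -> Ck k A (fun x => l (f x)).
Proof.
move=> oA cl; elim: k f => [|k IH] f.
  by move=> cf x Ax; apply: (@continuous_comp _ _ _ f l); [exact: cf|exact: cl].
move=> [df dfk].
have dl x : A x -> is_diff x (fun x => l (f x)) (fun v => l ('d f x v)).
  move=> Ax; apply: (@is_diff_comp _ _ _ _ f _ l l); first exact/differentiableP/df.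
  by apply: DiffDef; [exact: linear_differentiable|rewrite diff_lin].
split=> [x Ax|v]; first by have [] := dl x Ax.
by apply: eq_Ck (IH _ (dfk v)) => // x Ax; have [_ ->] := dl x Ax.
Qed.

Lemma Ck_pair U V W k (A : set U) (f : U -> V) (g : U -> W) : open A ->
  Ck k A f -> Ck k A g -> Ck k A (fun x => (f x, g x)).
Proof.
move=> oA; elim: k f g => [|k IH] f g.
  by move=> cf cg x Ax; apply: cvg_pair; [exact: cf|exact: cg].
move=> [df dfk] [dg dgk].
have dp x : A x ->
    is_diff x (fun x => (f x, g x)) (fun v => ('d f x v, 'd g x v)).
  by move=> Ax; apply: is_diff_pair; apply: differentiableP; [exact: df|exact: dg].
split=> [x Ax|v]; first by have [] := dp x Ax.
by apply: eq_Ck (IH _ _ (dfk v) (dgk v)) => // x Ax; have [_ ->] := dp x Ax.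
Qed.

(** Finite-dimensionality, in the form in which the chain rule uses it: vectors
    are expanded along finitely many directions, with continuous coordinates. *)
Definition fdim W := exists (I : finType) (e : I -> W) (c : I -> {linear W -> R^o}),
  (forall i, continuous (c i)) /\ forall w, w = \sum_i c i w *: e i.

(** The derivatives of [Ck] are taken in one fixed direction, while the chain
    rule differentiates [g] in the varying direction ['d f x v]. Expanding that
    direction in a basis of [V] leaves products of scalar functions with derivatives
    of [g] in fixed directions, to which the induction hypothesis applies. *)
Lemma Ck_comp U V W k (A : set U) (B : set V) (f : U -> V) (g : V -> W) :
  fdim V -> open A -> open B -> (forall x, A x -> B (f x)) ->
  Ck k A f -> Ck k B g -> Ck k A (g \o f).
Proof.
move=> [n [e [c [cc ec]]]] oA oB AB.
elim: k f g AB => [|k IH] f g AB Cf Cg.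
  move=> x Ax; apply: continuous_comp; first exact: Cf.
  exact/Cg/AB.
have [df dfk] := Cf; have [dg dgk] := Cg.
have dgf x : A x -> is_diff x (g \o f)
    (fun v => \sum_i c i ('d f x v) *: 'd g (f x) (e i)).
  move=> Ax; apply: is_diff_eq.
    apply: is_diff_comp; apply: differentiableP; [exact: df|exact/dg/AB].
  apply/funext => v /=; rewrite [in LHS](ec ('d f x v)) linear_sum/=.
  by apply: eq_bigr => i _; rewrite linearZ.
split=> [x Ax|v]; first by have [] := dgf x Ax.
apply: (@eq_Ck _ _ _ _ (fun x => \sum_i c i ('d f x v) *: 'd g (f x) (e i))) => //.
  by move=> x Ax; have [_ ->] := dgf x Ax.
apply: Ck_sum => // i; apply: CkZ => //.
  by apply: (Ck_linear_comp oA (cc i)); exact: dfk.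
exact: (IH f (fun y => 'd g y (e i)) AB (Ck_leS Cf) (dgk (e i))).
Qed.

Lemma fdimR : fdim R^o.
Proof.
exists 'I_1, (fun=> 1), (fun=> idfun); split; first by move=> _ x.
by move=> w; rewrite big_ord1 /= [_ *: _]mulr1.
Qed.

Lemma fdim_rV n : fdim 'rV[R]_n.
Proof.
have lc (i : 'I_n) : linear (fun w : 'rV[R]_n => w 0 i : R^o).
  by move=> a u v; rewrite !mxE.
pose c (i : 'I_n) : {linear 'rV[R]_n -> R^o} :=
  HB.pack (fun w : 'rV[R]_n => w 0 i : R^o)
    (GRing.isLinear.Build _ _ _ _ _ (lc i)).
exists 'I_n, (fun i => delta_mx 0 i), c; split=> [i|w].
  exact: coord_continuous.
exact: row_sum_delta.
Qed.

Lemma fdim_pair V W : fdim V -> fdim W -> fdim (V * W)%type.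
Proof.
move=> [I [e [c [cc ec]]]] [J [e' [c' [cc' ec']]]].
exists (I + J)%type, (fun i => match i with
    inl i => (e i, 0) | inr i => (0, e' i) end),
  (fun i => match i return {linear (V * W)%type -> R^o} with
    | inl i => c i \o fst | inr i => c' i \o snd end).
split=> [[i|j]|[v w]].
- by move=> p; apply: (@continuous_comp _ _ _ fst (c i)); [exact: cvg_fst|exact: cc].
- by move=> p; apply: (@continuous_comp _ _ _ snd (c' j)); [exact: cvg_snd|exact: cc'].
rewrite big_sumType/=.
have il (F : I -> V) : \sum_i (F i, 0 : W) = (\sum_i F i, 0).
  apply/esym; apply: (big_morph (fun v => (v, 0 : W))) => // x y.
  by congr pair; rewrite addr0.
have ir (F : J -> W) : \sum_j (0 : V, F j) = (0, \sum_j F j).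
  apply/esym; apply: (big_morph (fun w => (0 : V, w))) => // x y.
  by congr pair; rewrite addr0.
have sl a (x : V) : a *: (x, 0 : W) = (a *: x, 0) by congr pair; rewrite scaler0.
have sr a (x : W) : a *: (0 : V, x) = (0, a *: x) by congr pair; rewrite scaler0.
under eq_bigr do rewrite sl.
under [X in _ = _ + X]eq_bigr do rewrite sr.
rewrite il ir -ec -ec'; congr pair; by rewrite ?addr0 ?add0r.
Qed.

End Calculus.

Existing Class fdim.
#[local] Existing Instances fdimR fdim_rV fdim_pair.

(** * Maps smooth around a point *)

Section SmoothAt.
Context {R : realType}.
Implicit Types (U V W : normedModType R).

(** The neighbourhood is part of the notion: [Ck] on the singleton of [x] does not
    make [f] differentiable near [x], so that the chain rule would not hold near
    [x] and higher derivatives of compositions would be out of control. *)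
Definition smooth_at V W (f : V -> W) (x : V) : Prop :=
  exists A : set V, [/\ open A, A x & Csmooth A f].

Lemma smooth_at_Csmooth V W (A : set V) (f : V -> W) :
  (forall x, A x -> smooth_at f x) -> Csmooth A f.
Proof.
move=> h k; apply/Ck_pointwise => x /h [B [_ Bx /(_ k)]].
by apply: sub_Ck => _ ->.
Qed.

Lemma smooth_at_nbhs V W (f : V -> W) x (B : set V) : nbhs x B ->
  smooth_at f x -> exists A : set V, [/\ open A, A x, A `<=` B & Csmooth A f].
Proof.
rewrite nbhsE => -[C [oC Cx] CB] [A [oA Ax Af]].
exists (A `&` C); split=> //; first exact: openI.
  by move=> y [_ /CB].
by move=> k; apply: sub_Ck (Af k) => y [].
Qed.

Lemma near_smooth_at V W (f : V -> W) x :
  smooth_at f x -> \forall y \near x, smooth_at f y.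
Proof.
move=> [A [oA Ax Af]]; near=> y; exists A; split=> //.
by near: y; exact: open_nbhs_nbhs.
Unshelve. all: by end_near. Qed.

Lemma smooth_at_is_diff V W (f : V -> W) x :
  smooth_at f x -> is_diff x f ('d f x).
Proof. by move=> [A [oA Ax /(_ 1%N) [+ _]]] => /(_ _ Ax) /differentiableP. Qed.

Lemma smooth_at_continuous V W (f : V -> W) x :
  smooth_at f x -> {for x, continuous f}.
Proof. by move=> [A [oA Ax /(_ 0%N)]]; exact. Qed.

Lemma near_eq_smooth_at V W (f g : V -> W) x :
  {near x, f =1 g} -> smooth_at f x -> smooth_at g x.
Proof.
move=> fg /(smooth_at_nbhs fg) [A [oA Ax AB Af]]; exists A; split=> // k.
exact: eq_Ck (Af k).
Qed.

Lemma smooth_at_cst V W (c : W) (x : V) : smooth_at (cst c) x.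
Proof. by exists setT; split => //; [exact: openT|move=> k; exact: Ck_cst]. Qed.

Lemma smooth_at_lin V W (l : {linear V -> W}) x : continuous l -> smooth_at l x.
Proof.
by move=> cl; exists setT; split => //; [exact: openT|move=> k; exact: Ck_lin].
Qed.

Lemma smooth_at_id V (x : V) : smooth_at id x.
Proof. by apply: (@smooth_at_lin _ _ idfun) => y; exact: cvg_id. Qed.

Lemma smooth_atD V W (f g : V -> W) x :
  smooth_at f x -> smooth_at g x -> smooth_at (fun y => f y + g y) x.
Proof.
move=> [A [oA Ax Af]] /(smooth_at_nbhs (open_nbhs_nbhs (conj oA Ax))).
move=> [B [oB Bx BA Bg]]; exists B; split=> // k; apply: CkD => //.
exact: sub_Ck (Af k).
Qed.

Lemma smooth_atZ V W (a : V -> R^o) (f : V -> W) x :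
  smooth_at a x -> smooth_at f x -> smooth_at (fun y => a y *: f y) x.
Proof.
move=> [A [oA Ax Af]] /(smooth_at_nbhs (open_nbhs_nbhs (conj oA Ax))).
move=> [B [oB Bx BA Bg]]; exists B; split=> // k; apply: CkZ => //.
exact: sub_Ck (Af k).
Qed.

Lemma smooth_at_pair U V W (f : U -> V) (g : U -> W) x :
  smooth_at f x -> smooth_at g x -> smooth_at (fun y => (f y, g y)) x.
Proof.
move=> [A [oA Ax Af]] /(smooth_at_nbhs (open_nbhs_nbhs (conj oA Ax))).
move=> [B [oB Bx BA Bg]]; exists B; split=> // k; apply: Ck_pair => //.
exact: sub_Ck (Af k).
Qed.

Lemma smooth_at_linear_comp U V W (f : U -> V) (l : {linear V -> W}) x :
  continuous l -> smooth_at f x -> smooth_at (fun y => l (f y)) x.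
Proof.
move=> cl [A [oA Ax Af]]; exists A; split=> // k; exact: Ck_linear_comp.
Qed.

Lemma smooth_at_comp U V W (f : U -> V) (g : V -> W) x : fdim V ->
  smooth_at f x -> smooth_at g (f x) -> smooth_at (g \o f) x.
Proof.
move=> fV fx [B [oB Bx Bg]].
have : nbhs x (f @^-1` B).
  by apply: (smooth_at_continuous fx); exact: open_nbhs_nbhs.
move=> /smooth_at_nbhs /(_ fx) [A [oA Ax AB Af]].
by exists A; split=> // k; exact: (Ck_comp fV oA oB AB (Af k) (Bg k)).
Qed.

Lemma smooth_at_sum V W (I : Type) (r : seq I) (f : I -> V -> W) x :
  (forall i, smooth_at (f i) x) -> smooth_at (fun y => \sum_(i <- r) f i y) x.
Proof.
move=> fx; elim: r => [|i r IH].
  rewrite (_ : (fun x => _) = cst 0); first exact: smooth_at_cst.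
  by apply/funext => y; rewrite big_nil.
rewrite (_ : (fun x => _) = (fun x => f i x + \sum_(j <- r) f j x)).
  exact: smooth_atD.
by apply/funext => y; rewrite big_cons.
Qed.

Lemma smooth_at_diffv V W (f : V -> W) x v :
  smooth_at f x -> smooth_at (fun y => 'd f y v) x.
Proof.
move=> [A [oA Ax Af]]; exists A; split=> // k.
by have [_] := Af k.+1; exact.
Qed.

(** Joint smoothness of the derivative in the base point and in the direction,
    obtained by expanding the direction in a basis. *)
Lemma smooth_at_diff U V W (f : V -> W) (g v : U -> V) x : fdim V ->
  smooth_at g x -> smooth_at f (g x) -> smooth_at v x ->
  smooth_at (fun y => 'd f (g y) (v y)) x.
Proof.
move=> fV gx fx vx; have [I [e [c [cc ec]]]] := fV.
rewrite (_ : (fun y => _) = (fun y => \sum_i c i (v y) *: 'd f (g y) (e i))).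
  apply: smooth_at_sum => i; apply: smooth_atZ; first exact: smooth_at_linear_comp.
  by apply: (@smooth_at_comp _ _ _ g (fun z => 'd f z (e i))) => //; exact: smooth_at_diffv.
apply/funext => y; rewrite [in LHS](ec (v y)) linear_sum/=.
by apply: eq_bigr => i _; rewrite linearZ.
Qed.

End SmoothAt.

(** * Manifolds and maps smooth at a point of a manifold *)

(** The local part of [is_manifold] together with the finite dimension of the
    model, as a class, so that it is inferred for Lie groups, for model spaces and for
    their products. *)
Class mfd (R : realType) (E : normedModType R) (M : topologicalType)
    (A : atlas E M) : Prop := Mfd {
  mfd_fdim : fdim E;
  mfd_chart : forall c, in_atlas A c -> is_chart c;
  mfd_at : forall x, in_atlas A (chart_at A x) /\ chart_dom (chart_at A x) x;
  mfd_trans : forall c d, in_atlas A c -> in_atlas A d ->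
         Csmooth (chart_map c @` (chart_dom c `&` chart_dom d))
                 (chart_map d \o chart_inv c) }.

Section Charts.
Context {R : realType} {E : normedModType R} {M : topologicalType}.
Context {A : atlas E M} {mA : mfd A}.
Implicit Types (c d : chart E M).

Lemma chart_near c x : in_atlas A c -> chart_dom c x -> \forall y \near x, chart_dom c y.
Proof. by move=> /mfd_chart [oc _ _ _ _] cx; exact: open_nbhs_nbhs. Qed.

Lemma chartK c x : in_atlas A c -> chart_dom c x -> chart_inv c (chart_map c x) = x.
Proof. by move=> /mfd_chart [_ _ h _ _]; exact: h. Qed.

Lemma chart_cont c x : in_atlas A c -> chart_dom c x -> {for x, continuous (chart_map c)}.
Proof. by move=> /mfd_chart [_ _ _ h _]; exact: h. Qed.

Lemma chart_inv_cont c x : in_atlas A c -> chart_dom c x ->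
  {for chart_map c x, continuous (chart_inv c)}.
Proof. by move=> /mfd_chart [_ _ _ _ h] cx; apply: h; exists x. Qed.

Lemma chart_image_near c x : in_atlas A c -> chart_dom c x ->
  \forall u \near chart_map c x, (chart_map c @` chart_dom c) u.
Proof.
move=> /mfd_chart [_ h _ _ _] cx; by apply: open_nbhs_nbhs; split.
Qed.

Lemma chart_inv_near c x (P : set M) : in_atlas A c -> chart_dom c x ->
  (\forall y \near x, P y) -> \forall u \near chart_map c x, P (chart_inv c u).
Proof.
move=> Ac cx Px; apply: (chart_inv_cont Ac cx).
by rewrite chartK.
Qed.

Lemma chart_invK c u : in_atlas A c -> (chart_map c @` chart_dom c) u ->
  chart_map c (chart_inv c u) = u.
Proof. by move=> Ac [x cx <-]; rewrite chartK. Qed.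

Lemma chart_inv_dom c u : in_atlas A c -> (chart_map c @` chart_dom c) u ->
  chart_dom c (chart_inv c u).
Proof. by move=> Ac [x cx <-]; rewrite chartK. Qed.

Lemma chart_image_nbhs c x (P : set M) : in_atlas A c -> chart_dom c x ->
  nbhs x P -> nbhs (chart_map c x) (chart_map c @` (chart_dom c `&` P)).
Proof.
move=> Ac cx Px; near=> u.
have cu : (chart_map c @` chart_dom c) u by near: u; exact: chart_image_near.
exists (chart_inv c u); last exact: chart_invK.
split; first exact: chart_inv_dom.
by near: u; exact: chart_inv_near.
Unshelve. all: by end_near. Qed.

(** Charts are open maps, so that the images occurring in [smooth_on] and in
    the compatibility of charts are neighbourhoods of their points. *)
Lemma Csmooth_smooth_at_chart (W : normedModType R) c x (P : set M) (f : E -> W) :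
  in_atlas A c -> chart_dom c x -> nbhs x P ->
  Csmooth (chart_map c @` (chart_dom c `&` P)) f -> smooth_at f (chart_map c x).
Proof.
move=> Ac cx /(chart_image_nbhs Ac cx); rewrite nbhsE => -[B [oB Bx] sB] h.
by exists B; split => // k; exact: sub_Ck (h k).
Qed.

Lemma trans_smooth c d x : in_atlas A c -> in_atlas A d ->
  chart_dom c x -> chart_dom d x ->
  smooth_at (chart_map d \o chart_inv c) (chart_map c x).
Proof.
move=> Ac Ad cx dx; apply: (Csmooth_smooth_at_chart Ac cx (chart_near Ad dx)).
exact: mfd_trans.
Qed.

Lemma chart_at_in x : in_atlas A (chart_at A x).
Proof. by have [] := mfd_at x. Qed.
Lemma chart_at_dom x : chart_dom (chart_at A x) x.
Proof. by have [] := mfd_at x. Qed.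

End Charts.
#[local] Hint Resolve chart_at_in chart_at_dom : core.

Section MSmooth.
Context {R : realType}.

(** All pairs of charts are required, in agreement with [smooth_on];
    [msmooth_chart] reduces this to a single pair. *)
Definition msmooth (E F : normedModType R) (M N : topologicalType)
  (A : atlas E M) (B : atlas F N) (f : M -> N) (x : M) : Prop :=
  (\forall y \near x, {for y, continuous f}) /\
  forall c d, in_atlas A c -> in_atlas B d -> chart_dom c x -> chart_dom d (f x) ->
    smooth_at (chart_map d \o f \o chart_inv c) (chart_map c x).

(** The local expression of [f] on [U] is defined on the image of
    [U `&` f @^-1` chart_dom d], which is open because [f] is continuous on [U]. *)
Lemma smooth_onP (E F : normedModType R) (M N : topologicalType)
  (A : atlas E M) (B : atlas F N) {mA : mfd A} {mB : mfd B} (U : set M) (f : M -> N) :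
  open U -> smooth_on A B U f <-> forall x, U x -> msmooth A B f x.
Proof.
move=> oU; split=> [[cf sf] x Ux|h].
  have nU : \forall y \near x, U y by exact: open_nbhs_nbhs.
  split; first by near=> y; apply: cf; near: y.
  move=> c d Ac Bd cx dx.
  have nP : nbhs x (U `&` f @^-1` chart_dom d).
    by apply: filterI => //; apply: (cf x Ux); exact: chart_near.
  apply: (Csmooth_smooth_at_chart Ac cx nP).
  by rewrite setIA; exact: sf.
split=> [x /h [h1 _]|c d Ac Bd]; first exact: nbhs_singleton h1.
apply: smooth_at_Csmooth => _ [x [[cx Ux] dx] <-].
by have [_] := h x Ux; exact.
Unshelve. all: by end_near. Qed.

(** Any other local expression of [f] is obtained from the given one by composing
    with changes of charts on both sides. *)
Lemma msmooth_chart (E F : normedModType R) (M N : topologicalType)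
  (A : atlas E M) (B : atlas F N) {mA : mfd A} {mB : mfd B} (f : M -> N) x c d :
  in_atlas A c -> in_atlas B d -> chart_dom c x -> chart_dom d (f x) ->
  (\forall y \near x, {for y, continuous f}) ->
  smooth_at (chart_map d \o f \o chart_inv c) (chart_map c x) ->
  msmooth A B f x.
Proof.
move=> Ac Bd cx dx cf sf; split=> // c' d' Ac' Bd' cx' dx'.
have fE : fdim E by exact: mfd_fdim.
have fF : fdim F by exact: mfd_fdim.
have cfx : {for x, continuous f} by exact: nbhs_singleton cf.
pose T1 := chart_map c \o chart_inv c'; pose T2 := chart_map d' \o chart_inv d.
have e1 : T1 (chart_map c' x) = chart_map c x by rewrite /T1/= chartK.
have s1 : smooth_at T1 (chart_map c' x) by exact: trans_smooth.
have s2 : smooth_at T2 (chart_map d (f x)) by exact: trans_smooth.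
have s3 : smooth_at (chart_map d \o f \o chart_inv c \o T1) (chart_map c' x).
  by apply: smooth_at_comp => //; rewrite e1.
have s4 : smooth_at (T2 \o (chart_map d \o f \o chart_inv c \o T1)) (chart_map c' x).
  by apply: smooth_at_comp => //; rewrite /= e1 chartK.
apply: near_eq_smooth_at s4; rewrite /T1 /T2/=.
near=> u => /=.
rewrite !chartK//; near: u.
- by apply: (chart_inv_near Ac' cx'); exact: chart_near.
- by apply: (chart_inv_near Ac' cx' (P := f @^-1` chart_dom d)); apply: cfx; exact: chart_near.
- by apply: (chart_inv_near Ac' cx'); exact: chart_near.
Unshelve. all: by end_near. Qed.

End MSmooth.

#[local] Instance mfd_model (R : realType) (E : normedModType R) {fE : fdim E} :
  mfd (model_atlas E).
Proof.
split=> // [c ->|c d -> ->] /=.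
  split=> //=; try exact: openT.
  - by rewrite image_id; exact: openT.
  - by move=> x _; exact: cvg_id.
  - by move=> x _; exact: cvg_id.
by apply: smooth_at_Csmooth => x _; exact: smooth_at_id.
Qed.

Lemma smooth_at_fst (R : realType) (U V W : normedModType R) (f : U -> V * W) x :
  smooth_at f x -> smooth_at (fun y => (f y).1) x.
Proof.
move=> fx; apply: (@smooth_at_linear_comp _ _ _ _ f fst) => // p; exact: cvg_fst.
Qed.

Lemma smooth_at_snd (R : realType) (U V W : normedModType R) (f : U -> V * W) x :
  smooth_at f x -> smooth_at (fun y => (f y).2) x.
Proof.
move=> fx; apply: (@smooth_at_linear_comp _ _ _ _ f snd) => // p; exact: cvg_snd.
Qed.

Lemma open_setX (M N : topologicalType) (A : set M) (B : set N) :
  open A -> open B -> open (A `*` B).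
Proof.
move=> oA oB; rewrite openE => -[x y] [/= Ax By].
by exists (A, B) => //; split; exact: open_nbhs_nbhs.
Qed.

Section Prod.
Context {R : realType} {E F : normedModType R} {M N : topologicalType}.
Context {A : atlas E M} {B : atlas F N} {mA : mfd A} {mB : mfd B}.

Lemma mfd_prod : mfd (prod_atlas A B).
Proof.
have fE : fdim E by exact: mfd_fdim.
have fF : fdim F by exact: mfd_fdim.
have imE c d : chart_map (prod_chart c d) @` chart_dom (prod_chart c d) =
    (chart_map c @` chart_dom c) `*` (chart_map d @` chart_dom d)
    :> set (E * F).
  apply/seteqP; split=> [_ [[x y] [/= cx dy] <-]|[u v] [/= [x cx <-] [y dy <-]]].
    by split; [exists x|exists y].
  by exists (x, y).
split.
- exact: fdim_pair.
- move=> _ [c [d [Ac Bd ->]]].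
  have [oc oc' _ cc ci] := mfd_chart Ac; have [od od' _ cd di] := mfd_chart Bd.
  split.
  + exact: open_setX.
  + by rewrite imE; exact: open_setX.
  + by move=> [x y] [/= cx dy]; rewrite !chartK.
  + move=> [x y] [/= cx dy]; apply: cvg_pair.
      by apply: (@continuous_comp _ _ _ fst (chart_map c)); [exact: cvg_fst|exact: cc].
    by apply: (@continuous_comp _ _ _ snd (chart_map d)); [exact: cvg_snd|exact: cd].
  + rewrite imE => -[u v] [/= cu dv]; apply: cvg_pair.
      by apply: (@continuous_comp _ _ _ fst (chart_inv c)); [exact: cvg_fst|exact: ci].
    by apply: (@continuous_comp _ _ _ snd (chart_inv d)); [exact: cvg_snd|exact: di].
- move=> [x y]; split; last by split; exact: chart_at_dom.
  by exists (chart_at A x), (chart_at B y); split=> //; exact: chart_at_in.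
- move=> _ _ [c [d [Ac Bd ->]]] [c' [d' [Ac' Bd' ->]]].
  apply: smooth_at_Csmooth => _ [[x y] [[/= cx dy] [/= cx' dy']] <-].
  apply: smooth_at_pair.
    apply: (@smooth_at_comp _ _ _ _ fst (chart_map c' \o chart_inv c)) => //.
      by apply: smooth_at_fst; exact: smooth_at_id.
    exact: trans_smooth.
  apply: (@smooth_at_comp _ _ _ _ snd (chart_map d' \o chart_inv d)) => //.
    by apply: smooth_at_snd; exact: smooth_at_id.
  exact: trans_smooth.
Qed.

End Prod.

#[local] Existing Instance mfd_prod.

Section Maps.
Context {R : realType} {E1 E2 : normedModType R} {M N : topologicalType}.
Context {A : atlas E1 M} {B : atlas E2 N} {mA : mfd A} {mB : mfd B}.

Lemma msmooth_cont (f : M -> N) x : msmooth A B f x -> {for x, continuous f}.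
Proof. by move=> [+ _] => /nbhs_singleton. Qed.

Lemma msmooth_at (f : M -> N) x : msmooth A B f x ->
  smooth_at (chart_map (chart_at B (f x)) \o f \o chart_inv (chart_at A x))
    (chart_map (chart_at A x) x).
Proof.
move=> [_]; apply; [exact: chart_at_in|exact: chart_at_in|..].
  exact: chart_at_dom.
exact: chart_at_dom.
Qed.

Lemma msmooth_cst (y : N) x : msmooth A B (cst y) x.
Proof.
apply: (@msmooth_chart _ _ _ _ _ _ _ _ _ _ x (chart_at A x) (chart_at B y)).
- exact: chart_at_in.
- exact: chart_at_in.
- exact: chart_at_dom.
- exact: chart_at_dom.
- by near=> z; exact: cst_continuous.
- exact: (smooth_at_cst (chart_map (chart_at B y) y)).
Unshelve. all: by end_near. Qed.

Lemma msmooth_id x : msmooth A A id x.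
Proof.
split; first by near=> y; exact: cvg_id.
by move=> c d Ac Ad cx dx; exact: trans_smooth.
Unshelve. all: by end_near. Qed.

Lemma msmooth_chart_map c x : in_atlas A c -> chart_dom c x ->
  msmooth A (model_atlas E1) (chart_map c) x.
Proof.
move=> Ac cx.
have fE : fdim E1 by exact: mfd_fdim.
apply: (@msmooth_chart _ _ _ _ _ _ _ _ _ _ x c (Chart setT id id)) => //.
  by apply: filterS (chart_near Ac cx) => y; exact: chart_cont.
exact: trans_smooth.
Qed.

Lemma msmooth_chart_inv c x : in_atlas A c -> chart_dom c x ->
  msmooth (model_atlas E1) A (chart_inv c) (chart_map c x).
Proof.
move=> Ac cx.
have fE : fdim E1 by exact: mfd_fdim.
apply: (@msmooth_chart _ _ _ _ _ _ _ _ _ _ _ (Chart setT id id) c) => //.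
- by rewrite chartK.
- apply: filterS (chart_image_near Ac cx) => _ [y cy <-].
  exact: chart_inv_cont.
- exact: trans_smooth.
Qed.

End Maps.

Section Composition.
Context {R : realType} {E1 E2 E3 : normedModType R} {M N P : topologicalType}.
Context {A : atlas E1 M} {B : atlas E2 N} {C : atlas E3 P}.
Context {mA : mfd A} {mB : mfd B} {mC : mfd C}.

(** It suffices to consider the preferred charts at [x], [f x] and [g (f x)]; the
    middle chart cancels near [x]. *)
Lemma msmooth_comp (f : M -> N) (g : N -> P) x :
  msmooth A B f x -> msmooth B C g (f x) -> msmooth A C (g \o f) x.
Proof.
move=> fx gx; have cfx := msmooth_cont fx.
have fE : fdim E1 by exact: mfd_fdim.
have fF : fdim E2 by exact: mfd_fdim.
pose c := chart_at A x; pose d := chart_at B (f x); pose e := chart_at C (g (f x)).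
apply: (@msmooth_chart _ _ _ _ _ _ _ _ _ _ x c e);
  [exact: chart_at_in|exact: chart_at_in|exact: chart_at_dom|exact: chart_at_dom|..].
  have [cf _] := fx; have [cg _] := gx.
  near=> y; apply: continuous_comp; first by near: y.
  by near: y; exact: (cfx _ cg).
have s1 := msmooth_at fx; have s2 := msmooth_at gx.
have s3 : smooth_at ((chart_map e \o g \o chart_inv d) \o
    (chart_map d \o f \o chart_inv c)) (chart_map c x).
  apply: smooth_at_comp; first exact: s1.
  by rewrite /= chartK; [exact: s2|exact: chart_at_in|exact: chart_at_dom].
apply: near_eq_smooth_at s3.
near=> u; rewrite /= chartK//; first exact: chart_at_in.
near: u; apply: (chart_inv_near (chart_at_in x) (chart_at_dom x) (P := f @^-1` chart_dom d)).
apply: cfx; exact: (chart_near (chart_at_in _) (chart_at_dom _)).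
Unshelve. all: by end_near. Qed.

Lemma msmooth_pair (f : M -> N) (g : M -> P) x :
  msmooth A B f x -> msmooth A C g x -> msmooth A (prod_atlas B C) (fun y => (f y, g y)) x.
Proof.
move=> fx gx.
apply: (@msmooth_chart _ _ _ _ _ _ _ _ _ _ x
  (chart_at A x) (chart_at (prod_atlas B C) (f x, g x))).
- exact: chart_at_in.
- exact: chart_at_in.
- exact: chart_at_dom.
- exact: chart_at_dom.
- have [cf _] := fx; have [cg _] := gx.
  by near=> y; apply: cvg_pair; near: y.
- by apply: smooth_at_pair; [exact: (msmooth_at fx)|exact: (msmooth_at gx)].
Unshelve. all: by end_near. Qed.

End Composition.

Lemma msmooth_model (R : realType) (E F : normedModType R)
    {fE : fdim E} {fF : fdim F} (f : E -> F) x :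
  msmooth (model_atlas E) (model_atlas F) f x <-> smooth_at f x.
Proof.
split=> [[_ /(_ (Chart setT id id) (Chart setT id id))]|sf]; first exact.
apply: (@msmooth_chart _ _ _ _ _ _ _ _ _ _ _ (Chart setT id id) (Chart setT id id)) => //.
by apply: filterS (near_smooth_at sf) => y; exact: smooth_at_continuous.
Qed.

Section Projections.
Context {R : realType} {E1 E2 : normedModType R} {M N : topologicalType}.
Context {A : atlas E1 M} {B : atlas E2 N}.
Context {mA : mfd A} {mB : mfd B}.

Lemma msmooth_fst x : msmooth (prod_atlas A B) A fst x.
Proof.
have fE : fdim E1 by exact: mfd_fdim.
have fF : fdim E2 by exact: mfd_fdim.
split; first by near=> y; exact: cvg_fst.
move=> _ d [c [c' [Ac Ac' ->]]] Ad [/= cx _] dx.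
apply: (@smooth_at_comp _ _ _ _ fst (chart_map d \o chart_inv c)) => //.
  by apply: smooth_at_fst; exact: smooth_at_id.
exact: trans_smooth.
Unshelve. all: by end_near. Qed.

Lemma msmooth_snd x : msmooth (prod_atlas A B) B snd x.
Proof.
have fE : fdim E1 by exact: mfd_fdim.
have fF : fdim E2 by exact: mfd_fdim.
split; first by near=> y; exact: cvg_snd.
move=> _ d [c [c' [Ac Ac' ->]]] Ad [/= _ cx] dx.
apply: (@smooth_at_comp _ _ _ _ snd (chart_map d \o chart_inv c')) => //.
  by apply: smooth_at_snd; exact: smooth_at_id.
exact: trans_smooth.
Unshelve. all: by end_near. Qed.
End Projections.

(** * Tangent maps and velocities *)

Section Tangent.
Context {R : realType} {E F : normedModType R} {M N : topologicalType}.
Context {A : atlas E M} {B : atlas F N} {mA : mfd A} {mB : mfd B}.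

Lemma tangentD (f : M -> N) x u v :
  tangent A B f x (u + v) = tangent A B f x u + tangent A B f x v.
Proof. by rewrite /tangent linearD. Qed.

Lemma tangentN (f : M -> N) x u : tangent A B f x (- u) = - tangent A B f x u.
Proof. by rewrite /tangent linearN. Qed.

Lemma tangent0 (f : M -> N) x : tangent A B f x 0 = 0.
Proof. by rewrite /tangent linear0. Qed.

Lemma near_eq_tangent (f g : M -> N) x : msmooth A B f x ->
  {near x, f =1 g} -> tangent A B f x = tangent A B g x.
Proof.
move=> fx fg; rewrite /tangent -(nbhs_singleton fg).
have := near_eq_is_diff _ (smooth_at_is_diff (msmooth_at fx)).
move=> /(_ (chart_map (chart_at B (f x)) \o g \o chart_inv (chart_at A x))) h.
have [|_ <-//] := h.
apply: (chart_inv_near (chart_at_in x) (chart_at_dom x)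
  (P := fun y => chart_map (chart_at B (f x)) (f y) = chart_map (chart_at B (f x)) (g y))).
by apply: filterS fg => y ->.
Qed.

Lemma tangent_cst (y : N) x u : tangent A B (cst y) x u = 0.
Proof.
rewrite /tangent (_ : _ \o _ = cst (chart_map (chart_at B y) y)) ?diff_cst//.
Qed.

Lemma tangent_id x u : tangent A A id x u = u.
Proof.
rewrite /tangent.
have h : is_diff (chart_map (chart_at A x) x)
    (chart_map (chart_at A x) \o id \o chart_inv (chart_at A x)) id.
  apply: near_eq_is_diff (is_diff_id _).
  apply: filterS (chart_image_near (chart_at_in x) (chart_at_dom x)) => _ [y cy <-].
  by rewrite /= chartK//; exact: chart_at_in.
by rewrite diff_val.
Qed.

End Tangent.

Section ChainRule.
Context {R : realType} {E1 E2 E3 : normedModType R} {M N P : topologicalType}.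
Context {A : atlas E1 M} {B : atlas E2 N} {C : atlas E3 P}.
Context {mA : mfd A} {mB : mfd B} {mC : mfd C}.

(** The preferred chart at [f x] is used both for the target of the tangent map of
    [f] and for the source of that of [g], so that it cancels in the composition of
    the two local expressions. *)
Lemma tangent_comp (f : M -> N) (g : N -> P) x u :
  msmooth A B f x -> msmooth B C g (f x) ->
  tangent A C (g \o f) x u = tangent B C g (f x) (tangent A B f x u).
Proof.
move=> fx gx; rewrite /tangent.
have df := smooth_at_is_diff (msmooth_at (mA := mA) (mB := mB) fx).
have dg := smooth_at_is_diff (msmooth_at (mA := mB) (mB := mC) gx).
set c := chart_at A x in df *; set d := chart_at B (f x) in df dg *.
set e := chart_at C (g (f x)) in dg *.
have cE : (chart_map d \o f \o chart_inv c) (chart_map c x) = chart_map d (f x).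
  by rewrite /= chartK; [|exact: chart_at_in|exact: chart_at_dom].
move: dg; rewrite -cE => dg.
have h : {near chart_map c x, (chart_map e \o g \o chart_inv d) \o
    (chart_map d \o f \o chart_inv c) =1 chart_map e \o (g \o f) \o chart_inv c}.
  apply: (chart_inv_near (chart_at_in x) (chart_at_dom x)
    (P := fun y => chart_map e (g (chart_inv d (chart_map d (f y)))) = chart_map e (g (f y)))).
  have : \forall y \near x, chart_dom d (f y).
    by apply: (msmooth_cont fx); exact: (chart_near (chart_at_in _) (chart_at_dom _)).
  by apply: filterS => y dy; rewrite chartK//; exact: chart_at_in.
by have [_ ->] := near_eq_is_diff h (is_diff_comp df dg).
Qed.

Lemma tangent_pair (f : M -> N) (g : M -> P) x u :
  msmooth A B f x -> msmooth A C g x ->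
  tangent A (prod_atlas B C) (fun y => (f y, g y)) x u =
  (tangent A B f x u, tangent A C g x u).
Proof.
move=> fx gx; rewrite /tangent.
have df := smooth_at_is_diff (msmooth_at (mA := mA) (mB := mB) fx).
have dg := smooth_at_is_diff (msmooth_at (mA := mA) (mB := mC) gx).
by have [_ /= ->] := is_diff_pair df dg.
Qed.

End ChainRule.

Section PartialTangent.
Context {R : realType} {E1 E2 E3 : normedModType R} {M N P : topologicalType}.
Context {A : atlas E1 M} {B : atlas E2 N} {C : atlas E3 P}.
Context {mA : mfd A} {mB : mfd B} {mC : mfd C}.

Lemma msmooth_partial2 (F : M * N -> P) x y : msmooth (prod_atlas A B) C F (x, y) ->
  msmooth B C (fun y => F (x, y)) y.
Proof.
move=> Fxy; apply: (@msmooth_comp _ _ _ _ _ _ _ B (prod_atlas A B) C _ _ _ (fun y => (x, y))) => //.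
by apply: msmooth_pair; [exact: msmooth_cst|exact: msmooth_id].
Qed.

(** Split the tangent vector as [(u, 0) + (0, v)] and apply the chain rule to the
    two inclusions of the factors through [(x, y)]. *)
Lemma tangent_partial (F : M * N -> P) x y u v : msmooth (prod_atlas A B) C F (x, y) ->
  tangent (prod_atlas A B) C F (x, y) (u, v) =
  tangent A C (fun x => F (x, y)) x u + tangent B C (fun y => F (x, y)) y v.
Proof.
move=> Fxy.
have -> : (u, v) = (u, 0 : E2) + (0 : E1, v) by congr pair; rewrite ?addr0 ?add0r.
rewrite tangentD; congr (_ + _).
  rewrite -[LHS]/(tangent (prod_atlas A B) C F ((fun x => (x, y)) x) _).
  rewrite -[RHS]/(tangent A C (F \o (fun x => (x, y))) x u).
  rewrite (@tangent_comp _ _ _ _ _ _ _ A (prod_atlas A B) C)//.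
    by rewrite tangent_pair ?tangent_id ?tangent_cst//; [exact: msmooth_id|exact: msmooth_cst].
  by apply: msmooth_pair; [exact: msmooth_id|exact: msmooth_cst].
rewrite -[LHS]/(tangent (prod_atlas A B) C F ((fun y => (x, y)) y) _).
rewrite -[RHS]/(tangent B C (F \o (fun y => (x, y))) y v).
rewrite (@tangent_comp _ _ _ _ _ _ _ B (prod_atlas A B) C)//.
  by rewrite tangent_pair ?tangent_id ?tangent_cst//; [exact: msmooth_cst|exact: msmooth_id].
by apply: msmooth_pair; [exact: msmooth_cst|exact: msmooth_id].
Qed.

End PartialTangent.

Section Velocity.
Context {R : realType} {E F : normedModType R} {M N : topologicalType}.
Context {A : atlas E M} {B : atlas F N} {mA : mfd A} {mB : mfd B}.
Local Notation mR := (model_atlas R^o).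

Lemma velocity_comp (f : M -> N) (g : R^o -> M) t :
  msmooth mR A g t -> msmooth A B f (g t) ->
  velocity B (f \o g) t = tangent A B f (g t) (velocity A g t).
Proof. by move=> gt fgt; rewrite /velocity (tangent_comp (B := A)). Qed.

Lemma velocity_shift (g : R^o -> M) s t : msmooth mR A g (t + s) ->
  velocity A (fun r => g (r + s)) t = velocity A g (t + s).
Proof.
move=> gs; rewrite /velocity.
have h : is_diff t (fun r : R^o => r + s) id.
  have := is_diffD (is_diff_id t) (is_diff_cst s t).
  rewrite addr0; exact.
have hs : msmooth mR mR (fun r : R^o => r + s) t.
  apply/msmooth_model; apply: smooth_atD; [exact: smooth_at_id|exact: smooth_at_cst].
rewrite (tangent_comp (f := fun r : R^o => r + s) (g := g) _ hs gs).
by congr tangent; rewrite [LHS]/tangent/= diff_val.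
Qed.

Lemma velocity_cst (x : M) t : velocity A (cst x) t = 0.
Proof. exact: tangent_cst. Qed.

End Velocity.

(** For maps to a normed module the continuity near [x] follows from the
    smoothness of a single local expression. *)
Lemma msmooth_to_model (R : realType) (E F : normedModType R)
    (M : topologicalType) (A : atlas E M) {mA : mfd A} {fF : fdim F}
    (V : M -> F) c x : in_atlas A c -> chart_dom c x ->
  smooth_at (V \o chart_inv c) (chart_map c x) ->
  msmooth A (model_atlas F) V x.
Proof.
move=> Ac cx sV.
apply: (@msmooth_chart _ _ _ _ _ _ _ _ _ _ _ c (Chart setT id id)) => //.
have n1 := near_join (chart_near (mA := mA) Ac cx).
have n2 : \forall y \near x, smooth_at (V \o chart_inv c) (chart_map c y).
  exact: (chart_cont Ac cx (near_smooth_at sV)).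
near=> y.
have ny : \forall z \near y, chart_dom c z by near: y.
have cy : chart_dom c y := nbhs_singleton ny.
have e : {near y, (V \o chart_inv c) \o chart_map c =1 V}.
  by apply: filterS ny => z cz; rewrite /= chartK.
have k : {for y, continuous ((V \o chart_inv c) \o chart_map c)}.
  apply: continuous_comp; first exact: chart_cont.
  by apply: smooth_at_continuous; near: y.
have {}k : ((V \o chart_inv c) \o chart_map c) @ y --> V y.
  by move: k; rewrite -[in V y](chartK Ac cy).
by apply: cvg_trans k; exact: near_eq_cvg.
Unshelve. all: by end_near. Qed.

Section ParamVelocity.
Context {R : realType} {E F : normedModType R} {M N : topologicalType}.
Context {A : atlas E M} {B : atlas F N} {mA : mfd A} {mB : mfd B}.
Local Notation mR := (model_atlas R^o).

(** All the curves pass through [y0] at the relevant time, so that their velocities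
    are read in one and the same chart. There, the velocity is a partial
    derivative of a smooth map of the parameters and of the time. *)
Lemma msmooth_velocity (Psi : M * R^o -> N) (g : M -> R^o) (y0 : N) p0 :
  msmooth A mR g p0 -> msmooth (prod_atlas A mR) B Psi (p0, g p0) ->
  (forall p, Psi (p, g p) = y0) ->
  msmooth A (model_atlas F) (fun p => velocity B (fun t => Psi (p, t)) (g p)) p0.
Proof.
move=> gp Pp Py.
have fE : fdim E by exact: mfd_fdim.
have fF : fdim F by exact: mfd_fdim.
pose c := chart_at A p0; pose d := chart_at B y0.
have Ac : in_atlas A c by exact: chart_at_in.
have cx : chart_dom c p0 by exact: chart_at_dom.
pose psi (q : E * R^o) := chart_map d (Psi (chart_inv c q.1, q.2)).
have spsi : smooth_at psi (chart_map c p0, g p0).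
  rewrite /psi /d -(Py p0).
  exact: (msmooth_at (mA := mfd_prod (mA := mA) (mB := mfd_model (fE := fdimR))) Pp).
pose gc u := g (chart_inv c u).
have sgc : smooth_at gc (chart_map c p0) :=
  msmooth_at (mA := mA) (mB := mfd_model (fE := fdimR)) gp.
have sv : smooth_at (fun u => 'd psi (u, gc u) (0, 1)) (chart_map c p0).
  apply: smooth_at_diff.
  - by apply: smooth_at_pair; [exact: smooth_at_id|exact: sgc].
  - by rewrite /gc chartK.
  - exact: smooth_at_cst.
have key u : smooth_at psi (u, gc u) ->
    velocity B (fun t => Psi (chart_inv c u, t)) (gc u) = 'd psi (u, gc u) (0, 1).
  move=> pu; rewrite /velocity /tangent Py.
  have dp : is_diff (gc u) (fun t : R^o => (u, t)) (fun v => (0, v)).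
    by apply: is_diff_pair; exact: is_diff_id.
  have := is_diff_comp dp (smooth_at_is_diff pu).
  by move=> [_ ->].
have sv' : smooth_at ((fun p => velocity B (fun t => Psi (p, t)) (g p)) \o
    chart_inv c) (chart_map c p0).
  apply: near_eq_smooth_at sv; near=> u; rewrite /= key//; near: u.
  have cc := smooth_at_continuous (smooth_at_pair (smooth_at_id _) sgc).
  have e0 : (chart_map c p0, g p0) = (chart_map c p0, gc (chart_map c p0)).
    by rewrite /gc chartK.
  have := near_smooth_at spsi; rewrite e0; exact: cc.
exact: (msmooth_to_model Ac cx sv').
Unshelve. all: by end_near. Qed.

End ParamVelocity.

(** * Local existence of smooth solutions of differential equations *)

Section Picard.
Context {R : realType} {n : nat}.
Local Notation V := 'rV[R]_n.

Lemma rV_norm_le (v : V) C : 0 <= C -> (forall j, `|v 0 j| <= C) -> `|v| <= C.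
Proof.
move=> C0 h; rewrite /Num.Def.normr/= mx_normrE bigmax_le// => -[i j] _ /=.
by rewrite ord1.
Qed.

Lemma rV_coord_le (v : V) j : `|v 0 j| <= `|v|.
Proof.
rewrite [leRHS]/Num.Def.normr/= mx_normrE.
exact: (le_bigmax _ (fun ij : 'I_1 * 'I_n => `|v ij.1 ij.2|) (0, j)).
Qed.

Lemma is_derive_rV (f : R -> V) t (d : V) :
  (forall j, is_derive t (1:R) (fun s => f s 0 j) (d 0 j)) -> is_derive t (1:R) f d.
Proof.
move=> h.
have df : derivable f t 1.
  by apply/derivable_mxP => i j; rewrite ord1; have [] := h j.
apply: DeriveDef => //.
by rewrite derive_mx//; apply/rowP => j; rewrite mxE; have [_ ->] := h j.
Qed.

Lemma is_derive_coord (f : R -> V) t (d : V) j :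
  is_derive t (1:R) f d -> is_derive t (1:R) (fun s => f s 0 j) (d 0 j).
Proof.
move=> [df <-]; apply: DeriveDef; first by move/derivable_mxP : df; exact.
by rewrite derive_mx// mxE.
Qed.

Lemma continuous_rV (T : topologicalType) (f : T -> V) :
  (forall j, continuous (fun t => f t 0 j : R)) -> continuous f.
Proof.
move=> cf t; apply/cvgrPdist_le => e e0; near=> s.
apply: rV_norm_le; first exact: ltW.
move=> j; rewrite !mxE; move: j; near: s; apply: filter_forall => j.
by have /cvgrPdist_le := cf j t; apply.
Unshelve. all: by end_near. Qed.

(** The norm of ['rV_n] is the maximum of the coordinates, so that the scalar mean
    value theorem for each coordinate suffices. *)
Lemma mean_value_le (f d : R -> V) (a b C : R) : a <= b ->
  (forall t, a <= t <= b -> {for t, continuous f}) ->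
  (forall t, a < t < b -> is_derive t (1:R) f (d t)) ->
  (forall t, a < t < b -> `|d t| <= C) ->
  `|f b - f a| <= C * (b - a).
Proof.
rewrite le_eqVlt => /predU1P[->|ab] cf df dC; first by rewrite !subrr normr0 mulr0.
have C0 : 0 <= C by apply: le_trans (dC ((a + b) / 2) _); [exact: normr_ge0|lra].
apply: rV_norm_le => [|j]; first by rewrite mulr_ge0// subr_ge0 ltW.
rewrite !mxE.
have [||c] := @MVT _ (fun s => f s 0 j) (fun s => d s 0 j) a b ab.
- by move=> t; rewrite in_itv/= => tab; exact/is_derive_coord/df.
- apply: continuous_in_subspaceT => t; rewrite inE/= in_itv/= => tab.
  apply: (@continuous_comp _ _ _ f (fun v : V => v 0 j)); first exact: cf.
  exact: coord_continuous.
rewrite in_itv/= => cab ->; rewrite normrM [X in _ * X]gtr0_norm ?subr_gt0//.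
apply: ler_wpM2r; first by rewrite subr_ge0 ltW.
exact: le_trans (rV_coord_le _ _) (dC c cab).
Qed.

(** The intervals of radius [2 * K * 2^-1 ^+ k] around [u k] are nested; the limit is
    the supremum of their lower ends. *)
Lemma geometric_limit (u : nat -> R) K : (forall k, `|u k.+1 - u k| <= K * 2^-1 ^+ k) ->
  exists l, forall k, `|u k - l| <= 2 * K * 2^-1 ^+ k.
Proof.
move=> h.
pose q k : R := K * 2^-1 ^+ k.
have qS k : q k.+1 = q k / 2 by rewrite /q exprSr mulrA.
have q0 k : 0 <= q k by exact: le_trans (h k).
pose v k := u k - 2 * q k; pose w k := u k + 2 * q k.
have vS k : v k <= v k.+1.
  have := h k; rewrite -/(q k) ler_norml /v qS => /andP[]; lra.
have wS k : w k.+1 <= w k.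
  have := h k; rewrite -/(q k) ler_norml /w qS => /andP[]; lra.
have vw k : v k <= w k by have := q0 k; rewrite /v /w; lra.
have vm k m : (k <= m)%N -> v k <= v m.
  by move=> /subnK <-; elim: (m - k)%N => //= i IH; exact: le_trans IH (vS _).
have wm k m : (k <= m)%N -> w m <= w k.
  by move=> /subnK <-; elim: (m - k)%N => //= i IH; exact: le_trans (wS _) IH.
have vwkm k m : v k <= w m.
  apply: (le_trans (vm _ _ (leq_maxl k m))); apply: (le_trans (vw _)).
  by apply: wm; exact: leq_maxr.
exists (sup (range v)) => k.
have h1 : v k <= sup (range v).
  apply: ub_le_sup; last by exists k.
  by exists (w k) => _ [m _ <-].
have h2 : sup (range v) <= w k.
  by apply: ge_sup; [exists (v 0%N), 0%N|move=> _ [m _ <-]].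
rewrite ler_norml; move: h1 h2; rewrite /v /w /q.
by set z := K * _; rewrite -mulrA -/z; lra.
Qed.

Definition clamp (a b s : R) := Num.max a (Num.min b s).

Lemma clamp_bound a b s : a <= b -> a <= clamp a b s <= b.
Proof. by move=> ab; rewrite /clamp le_max lexx/= ge_max ab ge_min lexx. Qed.

Lemma clamp_id a b s : a <= s <= b -> clamp a b s = s.
Proof. by move=> /andP[a1 b1]; rewrite /clamp (min_idPr b1) (max_idPr a1). Qed.

Lemma clamp_dist a b s t : `|clamp a b s - clamp a b t| <= `|s - t|.
Proof.
rewrite /clamp /Order.max /Order.min.
case: (ltP b s) => bs; case: (ltP b t) => bt;
  repeat case: ifPn; rewrite ?ltNge ?negbK; rewrite -?ltNge => *; rewrite ?subrr ?normr0//;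
  rewrite ler_norml; case: (ger0P (s - t)) => ?; apply/andP; split; lra.
Qed.

Lemma clamp_continuous a b : continuous (clamp a b).
Proof.
move=> s; apply: (@continuous_max _ _ (cst a) (fun s => Num.min b s)).
  exact: cst_continuous.
by apply: (@continuous_min _ _ (cst b) id); [exact: cst_continuous|exact: cvg_id].
Qed.

(** The integral starts at [-2], because the fundamental theorem of calculus used
    here gives the derivative only to the right of the lower bound. *)
Lemma primitive1 (h : R -> R) : continuous h ->
  exists P : R -> R, P 0 = 0 /\ forall t : R, -2 < t < 2 -> is_derive t (1:R) P (h t).
Proof.
move=> ch.
pose F (t : R) : R := (\int[lebesgue_measure]_(s in [set` `[-2, t]]) h s)%R.
exists (fun t => F t - F 0); split; first by rewrite subrr.
move=> t /andP[t1 t2].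
have [|||dF F'] := @continuous_FTC1_closed R h (-2) t 2 t2.
- apply: continuous_compact_integrable; first exact: segment_compact.
  by apply: continuous_subspaceT.
- exact: t1.
- exact: ch.
have := is_deriveB (DeriveDef dF erefl) (is_derive_cst (F 0) t (1:R)).
by rewrite subr0 -derive1E F'.
Qed.

(** Precomposing with the truncation to the interval from -1 to 1 makes the
    primitive continuous on the whole line and controlled by its values on that
    interval, where the derivative is known. *)
Lemma primitive (h : R -> V) : continuous h ->
  exists P : R -> V, [/\ continuous P, P 0 = 0,
    forall t : R, P t = P (clamp (-1) 1 t) &
    forall t : R, -1 < t < 1 -> is_derive t (1:R) P (h t)].
Proof.
move=> ch.
have hj j : continuous (fun s => h s 0 j : R).
  move=> s; apply: (@continuous_comp _ _ _ h (fun v : V => v 0 j)).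
    exact: ch.
  exact: coord_continuous.
have [P HP] := choice (fun j => primitive1 (hj j)).
exists (fun t => \row_j P j (clamp (-1) 1 t)).
have c0 : clamp (-1) 1 0 = 0 by apply: clamp_id; lra.
have cc t : -1 <= clamp (-1) 1 t <= 1 by apply: clamp_bound; lra.
split.
- apply: continuous_rV => j.
  rewrite (_ : (fun t => _) = P j \o clamp (-1) 1); last first.
    by apply/funext => t; rewrite mxE.
  move=> t; apply: continuous_comp; first exact: clamp_continuous.
  apply: differentiable_continuous; apply/derivable1_diffP.
  by have [_ /(_ (clamp (-1) 1 t))[]//] := HP j; have := cc t; lra.
- by rewrite c0; apply/rowP => j; rewrite !mxE; have [] := HP j.
- by move=> t; apply/rowP => j; rewrite !mxE (clamp_id (cc t)).
- move=> t t1; apply: is_derive_rV => j.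
  apply: (@near_eq_is_derive _ _ _ (P j)); last by have [_] := HP j; apply; lra.
  near=> s; rewrite mxE clamp_id//.
  have : s \in `]-1, 1[ by near: s; apply: near_in_itvoo; rewrite in_itv.
  rewrite in_itv/=; lra.
Unshelve. all: by end_near. Qed.

Lemma primitive_le (D d : R -> V) C : continuous D -> D 0 = 0 ->
  (forall t : R, D t = D (clamp (-1) 1 t)) ->
  (forall t : R, -1 < t < 1 -> is_derive t (1:R) D (d t)) ->
  (forall t : R, `|d t| <= C) -> forall t, `|D t| <= C.
Proof.
move=> cD D0 Dc dD dC t; rewrite Dc.
have C0 : 0 <= C by exact: le_trans (dC 0).
have /andP[] : -1 <= clamp (-1) 1 t <= 1 by apply: clamp_bound; lra.
set c := clamp _ _ _ => c1 c2.
have [c0|c0] := leP 0 c.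
  have := @mean_value_le D d 0 c C c0 (fun t _ => cD t).
  rewrite D0 !subr0 => h; apply: le_trans (h _ _) _.
  - by move=> s s0; apply: dD; lra.
  - by move=> s _.
  - by rewrite ler_piMr.
have := @mean_value_le D d c 0 C (ltW c0) (fun t _ => cD t).
rewrite D0 !sub0r normrN => h; apply: le_trans (h _ _) _.
- by move=> s s0; apply: dD; lra.
- by move=> s _.
- by rewrite ler_piMr//; lra.
Qed.

(** Picard iteration for a right-hand side that is defined, bounded and contracting
    on the whole space. The iterates converge uniformly on the line at the rate
    [2^-1 ^+ k]; the limit is a fixed point because taking primitives vanishing at
    [0] does not increase the supremum norm on the interval from -1 to 1. *)
Lemma picard (g : R -> V -> V) (x0 : V) K :
  (forall x : R -> V, continuous x -> continuous (fun t => g t (x t))) ->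
  (forall t x y, `|g t x - g t y| <= 2^-1 * `|x - y|) ->
  (forall t x, `|g t x| <= K) ->
  exists x : R -> V, [/\ continuous x, x 0 = x0, forall t, `|x t - x0| <= K &
    forall t : R, -1 < t < 1 -> is_derive t (1:R) x (g t (x t))].
Proof.
move=> cg gL gK.
have prim_ex (h : R -> V) : exists P : R -> V, continuous h ->
    [/\ continuous P, P 0 = 0, forall t : R, P t = P (clamp (-1) 1 t) &
      forall t : R, -1 < t < 1 -> is_derive t (1:R) P (h t)].
  have [ch|nch] := pselect (continuous h); last by exists (fun=> 0).
  by have [P HP] := primitive ch; exists P.
have [prim Hp] := choice prim_ex.
have primB (h1 h2 : R -> V) C : continuous h1 -> continuous h2 ->
    (forall s, `|h1 s - h2 s| <= C) -> forall t, `|prim h1 t - prim h2 t| <= C.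
  move=> c1 c2 hC; have [p1 p2 p3 p4] := Hp _ c1; have [q1 q2 q3 q4] := Hp _ c2.
  apply: (@primitive_le (fun t => prim h1 t - prim h2 t) (fun t => h1 t - h2 t)) => //.
  - by move=> t; apply: continuousB; [exact: p1|exact: q1].
  - by rewrite p2 q2 subrr.
  - by move=> t; rewrite [in LHS]p3 [in LHS]q3.
  - by move=> t t1; exact: is_deriveB (p4 t t1) (q4 t t1).
have primK (h : R -> V) C : continuous h -> (forall s, `|h s| <= C) -> forall t, `|prim h t| <= C.
  move=> ch hC; have [p1 p2 p3 p4] := Hp _ ch.
  exact: (@primitive_le _ h).
pose X := fix X k : R -> V := if k is k'.+1
  then (fun t => x0 + prim (fun s => g s (X k' s)) t) else cst x0.
have cX k : continuous (X k).
  elim: k => [|k IH]; first by move=> t; exact: cst_continuous.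
  have [p1 _ _ _] := Hp _ (cg _ IH).
  by move=> t; apply: continuousD; [exact: cst_continuous|exact: p1].
have XS k t : `|X k.+1 t - X k t| <= K * 2^-1 ^+ k.
  elim: k t => [|k IH] t.
    rewrite expr0 mulr1 /X addrAC subrr add0r; apply: primK => //.
    by apply: cg => s; exact: cst_continuous.
  rewrite [X in `|X|](_ : _ = prim (fun s => g s (X k.+1 s)) t -
    prim (fun s => g s (X k s)) t); last first.
    by rewrite [X k.+2]/= [in X k.+1 t]/= opprD addrACA subrr add0r.
  apply: primB; [exact/cg/cX|exact/cg/cX|] => s.
  apply: le_trans (gL _ _ _) _; rewrite exprS mulrCA ler_wpM2l//.
have [x xX] : exists x : R -> V, forall k t, `|X k t - x t| <= 2 * K * 2^-1 ^+ k.
  have h t j : exists l : R, forall k, `|X k t 0 j - l| <= 2 * K * 2^-1 ^+ k.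
    apply: geometric_limit => k; apply: le_trans (XS k t).
    by have := rV_coord_le (X k.+1 t - X k t) j; rewrite !mxE.
  have h' t : exists l : 'I_n -> R, forall j k, `|X k t 0 j - l j| <= 2 * K * 2^-1 ^+ k.
    by have [l Hl] := choice (h t); exists l.
  have [l Hl] := choice h'.
  exists (fun t => \row_j l t j) => k t; apply: rV_norm_le => [|j].
    rewrite -mulrA mulr_ge0//; exact: le_trans (XS k t).
  by rewrite !mxE; exact: Hl.
have small e : 0 < e -> exists k, 2 * K * 2^-1 ^+ k < e.
  move=> e0.
  have : (2 * K) * (2^-1 : R) ^+ k @[k --> \oo] --> (2 * K) * 0.
    apply: cvgM; first exact: cvg_cst.
    by apply: cvg_expr; rewrite ger0_norm ?invr_ge0//; lra.
  rewrite mulr0 => /cvgr0_norm_lt /(_ _ e0) [k _ /(_ k (leqnn k))] h.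
  by exists k; apply: le_lt_trans h; exact: ler_norm.
have cx : continuous x.
  move=> t; apply/cvgrPdist_lt => e e0.
  have [k ke] := small (e / 3) ltac:(lra).
  have /cvgrPdist_lt /(_ (e/3)) h := cX k t.
  near=> s.
  have h1 := xX k t; have h2 := xX k s.
  have h3 : `|X k t - X k s| < e / 3 by near: s; apply: h; rewrite divr_gt0.
  rewrite (_ : x t - x s = - (X k t - x t) + (X k t - X k s) + (X k s - x s)); last first.
    by apply/rowP => j; rewrite !mxE; ring.
  apply: le_lt_trans (ler_normD _ _) _; apply: le_lt_trans (lerD (ler_normD _ _) (lexx _)) _.
  rewrite normrN; lra.
(* Both sides are limits of [X k.+1 t]: on the left because [g] is contracting
   in its second argument. *)
have yx t : x0 + prim (fun s => g s (x s)) t = x t.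
  apply/eqP; rewrite -subr_eq0 -normr_le0; apply/ler_addgt0Pl => e e0; rewrite addr0.
  have [k ke] := small (e / 2) ltac:(lra).
  have h1 : `|prim (fun s => g s (x s)) t - prim (fun s => g s (X k s)) t| <= 2 * K * 2^-1 ^+ k.
    apply: primB; [exact: cg|exact/cg/cX|] => s.
    apply: le_trans (gL _ _ _) _; rewrite distrC.
    apply: le_trans (xX k s); rewrite ler_piMl//; lra.
  have h2 := xX k.+1 t.
  have h3 : 2 * K * 2^-1 ^+ k.+1 <= 2 * K * 2^-1 ^+ k.
    rewrite ler_wpM2l//; first by rewrite mulr_ge0//; exact: le_trans (gK 0 0).
    by rewrite exprS ler_piMl ?exprn_ge0 ?invr_ge0//; lra.
  rewrite [X in `|X|](_ : _ = (prim (fun s => g s (x s)) t -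
    prim (fun s => g s (X k s)) t) + (X k.+1 t - x t)); last first.
    by apply/rowP => j; rewrite !mxE; ring.
  by apply: le_trans (ler_normD _ _) _; lra.
have [p1 p2 p3 p4] := Hp _ (cg _ cx).
exists x; split=> //.
- by rewrite -yx p2 addr0.
- by move=> t; rewrite -yx addrAC subrr add0r; apply: primK => //; exact: cg.
- move=> t t1.
  have := is_deriveD (is_derive_cst x0 t (1:R)) (p4 t t1); rewrite add0r.
  suff -> : (cst x0 + prim (fun s => g s (x s))) = x by [].
  by apply/funext => s; exact: yx.
Unshelve. all: by end_near. Qed.

End Picard.

Section LocalSolution.
Context {R : realType} {n : nat}.
Local Notation V := 'rV[R]_n.

Lemma is_derive_is_diff (W : normedModType R) (f : R^o -> W) (t : R^o) d :
  is_derive t (1 : R^o) f d -> is_diff t f (fun v => v *: d).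
Proof.
move=> [df <-]; apply: DiffDef; first exact/derivable1_diffP.
by rewrite deriv1E// derive1E.
Qed.

Lemma is_diff_is_derive (W : normedModType R) (f : R^o -> W) (t : R^o) df :
  is_diff t f df -> is_derive t (1 : R^o) f (df 1).
Proof.
move=> [df1 <-]; apply: DeriveDef; first exact/derivable1_diffP.
by rewrite deriveE.
Qed.

Lemma convex_ball (x0 x y : V) r l : 0 <= l <= 1 ->
  `|x - x0| <= r -> `|y - x0| <= r -> `|x + l *: (y - x) - x0| <= r.
Proof.
move=> /andP[l0 l1] xr yr.
rewrite (_ : _ - x0 = (1 - l) *: (x - x0) + l *: (y - x0)); last first.
  by apply/rowP => j; rewrite !mxE; ring.
apply: le_trans (ler_normD _ _) _; rewrite !normrZ !ger0_norm ?subr_ge0//.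
rewrite (_ : r = (1 - l) * r + l * r); last by ring.
by rewrite lerD// ler_wpM2l// subr_ge0.
Qed.

Lemma near_norm_le (U W : normedModType R) (f : U -> W) x :
  {for x, continuous f} -> \forall y \near x, `|f y| <= `|f x| + 1.
Proof.
move=> /cvg_norm /cvgrPdist_le /(_ 1 ltr01); apply: filterS => y.
rewrite distrC => h; rewrite -lerBlDl; apply: le_trans h; exact: ler_norm.
Qed.

(** Near [(t0, x0)] the derivatives of [f] along the basis vectors of [V] are
    bounded by continuity, and the mean value inequality along a segment, which stays
    in the ball by convexity, turns their sum into a Lipschitz constant. *)
Lemma smooth_lipschitz (f : R^o * V -> V) (t0 : R) (x0 : V) :
  smooth_at f (t0, x0) -> exists r L K : R, [/\ 0 < r, 0 <= L, 0 <= K,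
    forall t x, `|t - t0| <= r -> `|x - x0| <= r -> smooth_at f (t, x) /\ `|f (t, x)| <= K &
    forall t x y, `|t - t0| <= r -> `|x - x0| <= r -> `|y - x0| <= r ->
      `|f (t, x) - f (t, y)| <= L * `|x - y|].
Proof.
move=> sf.
pose e (j : 'I_n) : R^o * V := (0, delta_mx 0 j).
pose C j := `|'d f (t0, x0) (e j)| + 1.
pose L := \sum_j C j; pose K := `|f (t0, x0)| + 1.
have C0 j : 0 <= C j by rewrite addr_ge0.
have nCj j : \forall q \near (t0 : R^o, x0), `|'d f q (e j)| <= C j.
  exact: near_norm_le (smooth_at_continuous (smooth_at_diffv (e j) sf)).
have nC : \forall q \near (t0 : R^o, x0), forall j, `|'d f q (e j)| <= C j.
  exact: (@filter_forall _ _ (fun j q => `|'d f q (e j)| <= C j) _ _ nCj).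
have nK : \forall q \near (t0 : R^o, x0), `|f q| <= K.
  exact: near_norm_le (smooth_at_continuous sf).
have [d /= d0 hd] := (nbhs_ballP _ _).1 (filterI (near_smooth_at sf) (filterI nC nK)).
pose r := d / 2; have r0 : 0 < r by rewrite divr_gt0.
have H t x : `|t - t0| <= r -> `|x - x0| <= r ->
    [/\ smooth_at f (t, x), forall j, `|'d f (t, x) (e j)| <= C j & `|f (t, x)| <= K].
  move=> tr xr; have [|h1 [h2 h3]] := hd (t, x); last by split.
  have rd : r < d by rewrite /r; lra.
  by split; rewrite -ball_normE /= distrC; [exact: le_lt_trans tr rd|exact: le_lt_trans xr rd].
exists r, L, K; split=> //.
- exact: sumr_ge0.
- by rewrite addr_ge0.
- by move=> t x tr xr; have [] := H t x tr xr.
move=> t x y tr xr yr; rewrite distrC [in leRHS]distrC.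
pose z (l : R) := x + l *: (y - x).
have z1 : z 1 = y by rewrite /z scale1r subrKC.
have z0 : z 0 = x by rewrite /z scale0r addr0.
have zr l : 0 <= l <= 1 -> `|z l - x0| <= r by move=> l1; exact: convex_ball.
have dz (l : R^o) : is_diff l (fun l : R^o => (t : R^o, z l)) (fun v => (0, v *: (y - x))).
  apply: is_diff_pair.
  have := is_diffD (is_diff_cst x l) (is_diff_scalel l (y - x)).
  by rewrite add0r; exact.
have df (l : R^o) : 0 <= l <= 1 ->
    is_diff l (fun l => f (t, z l)) (fun v => 'd f (t, z l) (0, v *: (y - x))).
  move=> /zr /(H t _ tr) [s _ _]; exact: (is_diff_comp (dz l) (smooth_at_is_diff s)).
rewrite -z1 -{1}z0.
have -> : L * `|z 1 - x| = L * `|z 1 - x| * (1 - 0) by rewrite subr0 mulr1.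
apply: (@mean_value_le _ _ (fun l => f (t, z l)) (fun l => 'd f (t, z l) (0, y - x)) 0 1) => //.
- by move=> l /df [dl _]; exact: differentiable_continuous.
- move=> l l01; have := is_diff_is_derive (df l ltac:(lra)).
  by rewrite scale1r.
move=> l l01; have [_ hC _] := H t (z l) tr (zr l ltac:(lra)).
have -> : (0, y - x) = \sum_j (y - x) 0 j *: e j :> R^o * V.
  rewrite [in LHS](row_sum_delta (y - x)).
  have il (F : 'I_n -> V) : \sum_i (0 : R^o, F i) = (0, \sum_i F i).
    apply/esym; apply: (big_morph (fun v => (0 : R^o, v))) => // u v.
    by congr pair; rewrite addr0.
  by rewrite -il; apply: eq_bigr => j _; congr pair; rewrite scaler0.
rewrite z1 linear_sum/= mulr_suml.
apply: le_trans (ler_norm_sum _ _ _) _; apply: ler_sum => j _.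
by rewrite linearZ normrZ mulrC ler_pM//; exact: rV_coord_le.
Qed.

(** A 1-Lipschitz retraction onto the closed ball of radius [r] around [x0], which
    is a cube for the norm of ['rV_n]. *)
Definition clamp_box (x0 : V) (r : R) (x : V) : V :=
  \row_j clamp (x0 0 j - r) (x0 0 j + r) (x 0 j).

Lemma clamp_box_bound x0 r x : 0 <= r -> `|clamp_box x0 r x - x0| <= r.
Proof.
move=> r0; apply: rV_norm_le => // j; rewrite !mxE.
have := @clamp_bound R (x0 0 j - r) (x0 0 j + r) (x 0 j) ltac:(lra).
by rewrite ler_norml; lra.
Qed.

Lemma clamp_box_id x0 r x : `|x - x0| <= r -> clamp_box x0 r x = x.
Proof.
move=> xr; apply/rowP => j; rewrite mxE clamp_id//.
have := le_trans (rV_coord_le (x - x0) j) xr.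
by rewrite !mxE ler_norml; lra.
Qed.

Lemma clamp_box_dist x0 r x y : `|clamp_box x0 r x - clamp_box x0 r y| <= `|x - y|.
Proof.
apply: rV_norm_le => // j; rewrite !mxE; apply: le_trans (clamp_dist _ _ _ _) _.
by have := rV_coord_le (x - y) j; rewrite !mxE.
Qed.

Lemma clamp_box_continuous x0 r : continuous (clamp_box x0 r).
Proof.
apply: continuous_rV => j.
rewrite (_ : (fun x => _) = clamp (x0 0 j - r) (x0 0 j + r) \o (fun x : V => x 0 j)).
  move=> x; apply: continuous_comp; first exact: coord_continuous.
  exact: clamp_continuous.
by apply/funext => x; rewrite mxE.
Qed.

(** Bootstrap: if [x] is of class C^k, then so is its derivative
    [t |-> f (t, x t)], and [x] is of class C^(k+1). *)
Lemma ode_smooth (f : R^o * V -> V) (x : R^o -> V) (A : set R^o) : open A ->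
  (forall t, A t -> smooth_at f (t, x t)) ->
  (forall t, A t -> is_diff t x (fun v => v *: f (t, x t))) -> Csmooth A x.
Proof.
move=> oA sf dx; elim=> [|k IH].
  by move=> t /dx [dt _]; exact: differentiable_continuous.
split=> [t /dx[]//|v].
apply: (@eq_Ck _ _ _ _ _ (fun t => v *: f (t, x t))) => //.
  by move=> t /dx [_ ->].
apply: CkZ => //; first exact: Ck_cst.
pose B := [set q | smooth_at f q].
have oB : open B by rewrite openE => q; exact: near_smooth_at.
apply: (@Ck_comp _ _ _ _ _ A B (fun t => (t, x t)) f) => //.
- apply: Ck_pair => //.
  by apply: (@Ck_lin _ _ _ _ _ idfun) => y; exact: cvg_id.
- by apply: smooth_at_Csmooth.
Qed.

(** With [r], [L] and [K] the radius, Lipschitz constant and bound of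
    [smooth_lipschitz], the equation is rescaled in time by a small factor [e], and
    its right-hand side truncated to the cube of radius [r]. The conditions on [e]
    make the new right-hand side 1/2-Lipschitz and bounded by [r]; its solution between
    the times -1 and 1 therefore stays in the cube, where the truncation has no effect. *)
Theorem ode_local (f : R^o * V -> V) (x0 : V) : smooth_at f (0, x0) ->
  exists (eps : R) (x : R^o -> V), [/\ 0 < eps, x 0 = x0,
    forall t, - eps < t < eps -> smooth_at x t &
    forall t, - eps < t < eps -> is_diff t x (fun v => v *: f (t, x t))].
Proof.
move=> /smooth_lipschitz[r [L [K [r0 L0 K0 fK fL]]]].
have [e [e0 er eL eK]] : exists e, [/\ 0 < e, e <= r, e * L <= 2^-1 & e * K <= r].
  pose b : R := (2 * (L + 1))^-1; pose c := r / (K + 1).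
  have b0 : 0 < b by rewrite invr_gt0; lra.
  have c0 : 0 < c by rewrite divr_gt0//; lra.
  exists (Num.min r (Num.min b c)); split.
  - by rewrite !lt_min r0 b0.
  - by rewrite ge_min lexx.
  - apply: (@le_trans _ _ (b * L)); first by rewrite ler_wpM2r// !ge_min lexx orbT.
    by rewrite /b ler_pdivrMl; lra.
  - apply: (@le_trans _ _ (c * K)); first by rewrite ler_wpM2r// !ge_min lexx !orbT.
    by rewrite /c mulrAC ler_pdivrMr; nra.
have cl t : `|e * clamp (-1) 1 t - 0| <= r.
  rewrite subr0 normrM gtr0_norm//; apply: le_trans er; apply: ler_piMr; first exact: ltW.
  by rewrite ler_norml; apply: clamp_bound; lra.
have bx x : `|clamp_box x0 r x - x0| <= r by apply: clamp_box_bound; exact: ltW.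
pose g (t : R) (x : V) := e *: f (e * clamp (-1) 1 t, clamp_box x0 r x).
have [|||y [cy y0 yr dy]] := @picard _ _ g x0 (e * K).
- move=> x cx t.
  apply: (@continuous_comp _ _ _
    (fun t => f (e * clamp (-1) 1 t, clamp_box x0 r (x t))) ( *:%R e));
    last exact: scaler_continuous.
  apply: (@continuous_comp _ _ _
    (fun t : R => (e * clamp (-1) 1 t : R^o, clamp_box x0 r (x t))) f).
    have c1 : {for t, continuous (fun t : R => e * clamp (-1) 1 t : R^o)}.
      by apply: (@continuousM R R (cst e)); [exact: cst_continuous|exact: clamp_continuous].
    have c2 : {for t, continuous (fun t : R => clamp_box x0 r (x t))}.
      apply: (@continuous_comp _ _ _ x (clamp_box x0 r)); first exact: cx.
      exact: clamp_box_continuous.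
    exact: (cvg_pair c1 c2).
  by have [s _] := fK _ _ (cl t) (bx (x t)); exact: smooth_at_continuous.
- move=> t x y; rewrite -scalerBr normrZ gtr0_norm//.
  apply: le_trans (_ : e * (L * `|x - y|) <= _); last by rewrite mulrA ler_wpM2r.
  apply: ler_wpM2l; [exact: ltW|]; apply: le_trans (fL _ _ _ _ _ _) _ => //.
  by rewrite ler_wpM2l//; exact: clamp_box_dist.
- move=> t x; rewrite normrZ gtr0_norm//; apply: ler_wpM2l; first exact: ltW.
  by have [] := fK _ _ (cl t) (bx x).
have key (t : R^o) : - e < t < e ->
    is_diff t (fun t : R^o => y (t / e)) (fun v => v *: f (t, y (t / e))).
  move=> te.
  have te1 : -1 < t / e < 1 by rewrite ltr_pdivrMr// ltr_pdivlMr//; lra.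
  have := is_derive_is_diff (dy _ te1).
  rewrite /g clamp_id; last lra.
  rewrite (mulrC e (t / e)) divfK ?gt_eqF// clamp_box_id; last exact: le_trans (yr _) eK.
  move=> h.
  have h2 : is_diff t (fun t : R^o => t / e : R^o) (fun v => v / e).
    have := is_diff_scalel t (e^-1 : R^o); exact.
  apply: is_diff_eq (is_diff_comp h2 h) _.
  by apply/funext => v /=; rewrite scalerA divfK ?gt_eqF.
exists e, (fun t => y (t / e)); split=> //; first by rewrite mul0r.
move=> t te.
exists `]-e, e[%classic; split.
- exact: interval_open.
- by rewrite /= in_itv.
have sA s : `]-e, e[%classic s -> -e < s < e by rewrite /= in_itv.
apply: (@ode_smooth f); first exact: interval_open.
  move=> s /sA se; have [||] // := fK s (y (s / e)); first by rewrite subr0 ler_norml; lra.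
  exact: le_trans (yr _) eK.
Qed.

End LocalSolution.

(** * Velocities in a Lie group *)

#[local] Instance mfd_lie (R : realType) (G : lieGroupType R) : mfd (lie_atlas G).
Proof.
have [_ _ h1 h2 h3] := @lie_manifold R G.
by split=> //; exact: fdim_rV.
Qed.

#[local] Instance fdim_lie_alg (R : realType) (G : lieGroupType R) : fdim (lie_alg G).
Proof. exact: fdim_rV. Qed.

Section LieGroup.
Context {R : realType} {H : lieGroupType R}.
Local Notation aH := (lie_atlas H).
Local Notation mR := (model_atlas R^o).

Section Smooth.
Context {E : normedModType R} {M : topologicalType} {A : atlas E M} {mA : mfd A}.

Lemma msmooth_mulg (f g : M -> H) x : msmooth A aH f x -> msmooth A aH g x ->
  msmooth A aH (fun y => (f y * g y)%g) x.
Proof.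
move=> fx gx.
apply: (@msmooth_comp _ _ _ _ _ _ _ A (prod_atlas aH aH) aH _ _ _ (fun y => (f y, g y))
  (fun p : H * H => (p.1 * p.2)%g)); first exact: msmooth_pair.
by have /smooth_onP := @lie_mul_smooth R H; apply; [exact: openT|].
Qed.

Lemma msmooth_invg (f : M -> H) x : msmooth A aH f x ->
  msmooth A aH (fun y => (f y)^-1%g) x.
Proof.
move=> fx; apply: (@msmooth_comp _ _ _ _ _ _ _ A aH aH _ _ _ f (fun y : H => y^-1%g)) => //.
by have /smooth_onP := @lie_inv_smooth R H; apply; [exact: openT|].
Qed.

End Smooth.

(** The partial maps of the multiplication at [(1, 1)] are the identity. *)
Lemma velocity_mulg1 (f g : R^o -> H) t : msmooth mR aH f t -> msmooth mR aH g t ->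
  f t = 1%g -> g t = 1%g ->
  velocity aH (fun s => (f s * g s)%g) t = velocity aH f t + velocity aH g t.
Proof.
move=> ft gt f1 g1.
pose mul (p : H * H) := (p.1 * p.2)%g.
have sm p : msmooth (prod_atlas aH aH) aH mul p.
  by apply: msmooth_mulg; [exact: msmooth_fst|exact: msmooth_snd].
have := @velocity_comp R _ _ _ _ (prod_atlas aH aH) aH _ _ mul (fun s => (f s, g s)) t
  (msmooth_pair ft gt) (sm _).
move=> ->; rewrite /velocity (tangent_pair _ ft gt) f1 g1 tangent_partial//.
have -> : (fun x : H => mul (x, 1%g)) = id by apply/funext => x; exact: mulg1.
have -> : (fun x : H => mul (1%g, x)) = id by apply/funext => x; exact: mul1g.
by congr (_ + _); exact: tangent_id.
Qed.

(** The product of [f] and its inverse is a constant curve. *)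
Lemma velocity_invg1 (f : R^o -> H) t : msmooth mR aH f t -> f t = 1%g ->
  velocity aH (fun s => (f s)^-1%g) t = - velocity aH f t.
Proof.
move=> ft f1; apply/eqP; rewrite -addr_eq0 addrC; apply/eqP.
rewrite -velocity_mulg1 ?f1 ?invg1//; last exact: msmooth_invg.
rewrite -[RHS](velocity_cst (A := aH) 1%g t); congr velocity.
by apply/funext => s; rewrite mulgV.
Qed.

End LieGroup.

Section Crossed.
Context {R : realType} {G H : lieGroupType R}.
Variable Theta : G -> H -> H.
Hypothesis TA : lie_action Theta.
Local Notation aG := (lie_atlas G).
Local Notation aH := (lie_atlas H).
Local Notation mR := (model_atlas R^o).

Lemma ThetaM a x y : Theta a (x * y)%g = (Theta a x * Theta a y)%g.
Proof. by case: TA => /(_ a) [h _] _ _ _; rewrite h. Qed.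

Lemma Theta1 a : Theta a 1%g = 1%g.
Proof. by apply: (mulgI (Theta a 1%g)); rewrite -ThetaM !mulg1. Qed.

Lemma ThetaV a x : Theta a x^-1%g = (Theta a x)^-1%g.
Proof. by apply: (mulgI (Theta a x)); rewrite -ThetaM !mulgV Theta1. Qed.

Lemma msmooth_Theta a x : msmooth aH aH (Theta a) x.
Proof.
have [_ _ _ /smooth_onP h] := TA.
exact: (msmooth_partial2 (h openT (a, x) I)).
Qed.

Lemma velocity_conj (a : G) (h : H) (c : R^o -> H) t : msmooth mR aH c t -> c t = 1%g ->
  velocity aH (fun s => (h * Theta a (c s) * h^-1)%g) t =
  Ad h (tTheta Theta a (velocity aH c t)).
Proof.
move=> ct c1.
have sc : msmooth mR aH (Theta a \o c) t.
  by apply: msmooth_comp ct _; exact: msmooth_Theta.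
have sh x : msmooth aH aH (fun x : H => (h * x * h^-1)%g) x.
  apply: msmooth_mulg; last exact: msmooth_cst.
  by apply: msmooth_mulg; [exact: msmooth_cst|exact: msmooth_id].
rewrite (velocity_comp (f := fun x : H => (h * x * h^-1)%g) sc (sh _)).
rewrite (velocity_comp ct (msmooth_Theta _ _)) /=.
by rewrite c1 Theta1.
Qed.

Lemma Theta_repN (D : G -> H) a u : Theta_rep Theta D a (- u) = - Theta_rep Theta D a u.
Proof. by rewrite /Theta_rep /tTheta tangentN /Ad tangentN. Qed.

Section Deformation.
Variables (DD : G * R^o -> H).
Hypothesis sDD : forall p, msmooth (prod_atlas aG mR) aH DD p.

Lemma msmooth_curve a t : msmooth mR aH (fun t => DD (a, t)) t.
Proof. exact: (msmooth_partial2 (sDD (a, t))). Qed.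

(** By the chain rule for the time shift and the right translation. The curve on the
    right passes through the identity, so that factorizations of it can be
    differentiated with [velocity_mulg1]. *)
Lemma hatDE s a : hatD DD s a = velocity aH (fun t => (DD (a, t) * (DD (a, s))^-1)%g) s.
Proof.
rewrite /hatD /at_time.
have sR x : msmooth aH aH (fun x : H => (x * (DD (a, s))^-1)%g) x.
  by apply: msmooth_mulg; [exact: msmooth_id|exact: msmooth_cst].
rewrite (velocity_comp (f := fun x : H => (x * (DD (a, s))^-1)%g) (msmooth_curve a s) (sR _)).
have := @velocity_shift R _ _ aH _ (fun t => DD (a, t)) s 0.
by rewrite add0r => ->//; exact: msmooth_curve.
Qed.

Lemma smooth_hatD s : smooth_on aG (model_atlas (lie_alg H)) setT (hatD DD s).
Proof.
apply/smooth_onP; first exact: openT.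
move=> a _.
pose Psi (p : G * R^o) := (DD p * (DD (p.1, s))^-1)%g.
have -> : hatD DD s = (fun a => velocity aH (fun t => Psi (a, t)) ((cst s : G -> R^o) a)).
  by apply/funext => b; exact: hatDE.
apply: (@msmooth_velocity R _ _ _ _ aG aH _ _ Psi (cst s : G -> R^o) 1%g a) => [||b].
- exact: msmooth_cst.
- apply: msmooth_mulg => //; apply: msmooth_invg.
  apply: (@msmooth_comp _ _ _ _ _ _ _ _ (prod_atlas aG mR) aH _ _ _
    (fun p : G * R^o => (p.1, s : R^o)) DD) => //.
  by apply: msmooth_pair; [exact: msmooth_fst|exact: msmooth_cst].
- by rewrite /Psi mulgV.
Qed.

End Deformation.

End Crossed.

(** * Curves with a given right logarithmic derivative *)

Section RightODE.
Context {R : realType} {H : lieGroupType R}.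
Local Notation aH := (lie_atlas H).
Local Notation mR := (model_atlas (R^o)).
Local Notation V := 'rV[R]_(lie_dim H).

(** Transporting [k s] from the identity to [y] by right translation gives, in the
    chart at [1], the vector field ['d m (phi 1, y) (k s, 0)], where [m] is the local
    expression of the group law; it is smooth in [(s, y)], and its integral curve
    through [phi 1] is the local expression of [tau]. *)
Lemma right_ode (k : R^o -> V) : (forall t, smooth_at k t) ->
  exists (eps : R) (tau : R^o -> H), [/\ 0 < eps, tau 0 = 1%g,
    forall t, - eps < t < eps -> msmooth mR aH tau t &
    forall s, - eps < s < eps ->
      velocity aH (fun t => (tau t * (tau s)^-1)%g) s = k s].
Proof.
move=> sk.
pose c := chart_at aH 1%g; pose phi := chart_map c.
have Hc : in_atlas aH c by exact: chart_at_in.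
have c1 : chart_dom c 1%g by exact: chart_at_dom.
pose m (w : V * V) := phi (chart_inv c w.1 * chart_inv c w.2)%g.
have sm : smooth_at m (phi 1%g, phi 1%g).
  have : msmooth (prod_atlas aH aH) aH (fun p : H * H => (p.1 * p.2)%g) (1%g, 1%g).
    by apply: msmooth_mulg; [exact: msmooth_fst|exact: msmooth_snd].
  move=> [_ /(_ (prod_chart c c) c)]; apply => //; last by rewrite /= mulg1.
  by exists c, c.
pose f (q : R^o * V) := 'd m (phi 1%g, q.2) (k q.1, 0).
have fdV : fdim (V * V)%type by exact: fdim_pair.
have sf : smooth_at f (0, phi 1%g).
  apply: smooth_at_diff => //.
  - by apply: smooth_at_pair; [exact: smooth_at_cst|exact/smooth_at_snd/smooth_at_id].
  - apply: smooth_at_pair; last exact: smooth_at_cst.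
    apply: (@smooth_at_comp _ _ _ _ fst k); last exact: sk.
    exact/smooth_at_fst/smooth_at_id.
have [e [x [e0 x0 sx dx]]] := ode_local sf.
(* On a shorter interval the solution stays in the image of the chart, and the
   local group law is smooth at [(phi 1, x t)]. *)
have [d [d0 de xc xm]] : exists d, [/\ 0 < d, d <= e,
    forall t, -d < t < d -> (phi @` chart_dom c) (x t) &
    forall t, -d < t < d -> smooth_at m (phi 1%g, x t)].
  have cx : {for 0, continuous x} by apply: smooth_at_continuous; apply: sx; lra.
  have n1 : \forall t \near (0 : R^o), (phi @` chart_dom c) (x t).
    by apply: cx; rewrite x0; exact: chart_image_near.
  have n2 : \forall t \near (0 : R^o), smooth_at m (phi 1%g, x t).
    apply: (cx (fun u => smooth_at m (phi 1%g, u))); rewrite x0.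
    have cp : {for phi 1%g, continuous (fun u : V => (phi 1%g, u))}.
      apply: smooth_at_continuous.
      by apply: smooth_at_pair; [exact: smooth_at_cst|exact: smooth_at_id].
    exact: (cp _ (near_smooth_at sm)).
  have [d /= d0 hd] := (nbhs_ballP _ _).1 (filterI n1 n2).
  have md : Num.min d e <= d by rewrite ge_min lexx.
  exists (Num.min d e); split.
  - by rewrite lt_min d0.
  - by rewrite ge_min lexx orbT.
  - move=> t td; have [] // := hd t.
    rewrite /ball/= sub0r normrN ltr_norml.
    by lra.
  - move=> t td; have [] // := hd t.
    rewrite /ball/= sub0r normrN ltr_norml.
    by lra.
exists d, (fun t => chart_inv c (x t)).
have st t : -d < t < d -> msmooth mR aH (fun t => chart_inv c (x t)) t.
  move=> td; apply: (@msmooth_comp _ _ _ _ _ _ _ mR (model_atlas V) aH _ _ _ x (chart_inv c)).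
    by apply/msmooth_model; apply: sx; lra.
  by have [h ch <-] := xc t td; exact: msmooth_chart_inv.
split => //; first by rewrite x0 chartK.
move=> s sd.
have [h ch hx] := xc s sd.
rewrite -hx chartK//.
pose Rh (z : H) := (z * h)%g; pose Rh' (z : H) := (z * h^-1)%g.
have sRh z : msmooth aH aH Rh z by apply: msmooth_mulg; [exact: msmooth_id|exact: msmooth_cst].
have sRh' z : msmooth aH aH Rh' z by apply: msmooth_mulg; [exact: msmooth_id|exact: msmooth_cst].
have s1 : msmooth (model_atlas V) aH (Rh' \o chart_inv c) (x s).
  rewrite -hx; apply: msmooth_comp (sRh' _); exact: msmooth_chart_inv.
have s2 : msmooth aH (model_atlas V) (phi \o Rh) 1%g.
  by apply: msmooth_comp (sRh _) _; rewrite /Rh mul1g; exact: msmooth_chart_map.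
have sxs : msmooth mR (model_atlas V) x s by apply/msmooth_model; apply: sx; lra.
transitivity (tangent (model_atlas V) aH (Rh' \o chart_inv c) (x s)
  (velocity (model_atlas V) x s)).
  exact: (velocity_comp sxs s1).
have -> : velocity (model_atlas V) x s = tangent aH (model_atlas V) (phi \o Rh) 1%g (k s).
  rewrite /velocity /tangent /=.
  have [_ ->] := dx s ltac:(lra); rewrite scale1r /f /=.
  have dp : is_diff (phi 1%g) (fun u : V => (u, x s)) (fun v => (v, 0)).
    by apply: is_diff_pair; exact: is_diff_id.
  have := is_diff_comp dp (smooth_at_is_diff (xm s sd)).
  rewrite (_ : m \o _ = id \o (phi \o Rh) \o chart_inv c); last first.
    by apply/funext => u; rewrite /m/= -hx chartK.
  by move=> [_ ->].
have e1 : x s = (phi \o Rh) 1%g by rewrite /= /Rh mul1g.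
(* The composition of the tangent maps is that of a map which is the identity
   near [1]: the chart and the translation by [h] are undone. *)
rewrite e1 -tangent_comp -?e1//.
suff -> : tangent aH aH ((Rh' \o chart_inv c) \o (phi \o Rh)) 1%g =
    tangent aH aH id 1%g by exact: tangent_id.
apply: near_eq_tangent.
  by apply: msmooth_comp; [exact: s2|rewrite -e1].
have : \forall z \near (1%g : H), chart_dom c (z * h)%g.
  apply: (msmooth_cont (sRh 1%g)); rewrite /Rh mul1g; exact: chart_near.
by apply: filterS => z zc; rewrite /= /Rh/Rh' chartK// mulgK.
Qed.

End RightODE.

(** * Deformations of crossed homomorphisms *)

(** In one chart around [F 0] the derivative of [F] vanishes as well, by the
    chain rule, so that the mean value inequality applies with the constant [0]. *)
Lemma velocity0_locally_cst (R : realType) n (M : topologicalType)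
    (A : atlas 'rV[R]_n M) {mA : mfd A} (F : R^o -> M) (e : R) : 0 < e ->
  (forall t, - e < t < e -> msmooth (model_atlas R^o) A F t) ->
  (forall t, - e < t < e -> velocity A F t = 0) ->
  exists d : R, 0 < d <= e /\ forall t : R^o, - d < t < d -> F t = F 0.
Proof.
move=> e0 sF vF; pose c := chart_at A (F 0).
have Ac : in_atlas A c by exact: chart_at_in.
have cF : {for 0, continuous F} by apply: msmooth_cont (sF _ _); lra.
have n1 : \forall t \near (0 : R^o), chart_dom c (F t).
  by apply: cF; apply: chart_near => //; exact: chart_at_dom.
have [d /= d0 hd] := (nbhs_ballP _ _).1 n1.
have md : Num.min d e <= d by rewrite ge_min lexx.
have me : Num.min d e <= e by rewrite ge_min lexx orbT.
exists (Num.min d e); split; first by rewrite lt_min d0 e0.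
move=> t; move: md me; set r := Num.min d e => md me tr.
have cd s : - r < s < r -> chart_dom c (F s).
  by move=> sr; apply: hd; rewrite /ball/= sub0r normrN ltr_norml; lra.
pose f := chart_map c \o F.
have sf s : - r < s < r -> smooth_at f s.
  move=> sr; apply/msmooth_model; apply: msmooth_comp; first by apply: sF; lra.
  by apply: msmooth_chart_map => //; exact: cd.
have df s : - r < s < r -> is_derive s (1 : R^o) f 0.
  move=> sr.
  have -> : 0 = 'd f s 1 :> 'rV[R]_n.
    transitivity (tangent A (model_atlas _) (chart_map c) (F s) (velocity A F s)).
      by rewrite vF ?tangent0//; lra.
    rewrite -velocity_comp//; first by apply: sF; lra.
    by apply: msmooth_chart_map => //; exact: cd.
  by apply: is_diff_is_derive; exact/smooth_at_is_diff/sf.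
have ft : f t = f 0.
  apply/eqP; rewrite -subr_eq0 -normr_le0.
  have [t0|t0] := leP 0 t.
    have := @mean_value_le R n f (fun=> 0) 0 t 0 t0; rewrite mul0r; apply => s s0.
    - by apply: smooth_at_continuous; apply: sf; lra.
    - by apply: df; lra.
    - by rewrite normr0.
  rewrite distrC.
  have := @mean_value_le R n f (fun=> 0) t 0 0 (ltW t0); rewrite mul0r; apply => s s0.
  - by apply: smooth_at_continuous; apply: sf; lra.
  - by apply: df; lra.
  - by rewrite normr0.
rewrite -(chartK Ac (cd t tr)) -(chartK Ac (cd 0 _)); last by lra.
by congr chart_inv.
Qed.

Section Main.
Context {R : realType} {G H : lieGroupType R}.
Variables (Theta : G -> H -> H) (DD : G * R^o -> H).
Hypothesis TA : lie_action Theta.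
Local Notation aG := (lie_atlas G).
Local Notation aH := (lie_atlas H).
Local Notation mR := (model_atlas (R^o)).
Hypothesis sDD : forall p, msmooth (prod_atlas aG mR) aH DD p.
Hypothesis DDM : forall a b t, DD ((a * b)%g, t) = (DD (a, t) * Theta a (DD (b, t)))%g.
Let rep s := Theta_rep Theta (at_time DD s).

Let sratio (tau : R^o -> H) (s t : R^o) : msmooth mR aH tau t ->
  msmooth mR aH (fun t => (tau t * (tau s)^-1)%g) t.
Proof. by move=> st; apply: msmooth_mulg => //; exact: msmooth_cst. Qed.

Let sconj a h (c : R^o -> H) t : msmooth mR aH c t ->
  msmooth mR aH (fun t => (h * Theta a (c t) * h^-1)%g) t.
Proof.
move=> st; apply: msmooth_mulg; last exact: msmooth_cst.
apply: msmooth_mulg; first exact: msmooth_cst.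
by apply: msmooth_comp st _; exact: msmooth_Theta.
Qed.

(** With [c_a t = D_t(a) D_s(a)^-1], one has
    [c_ab t = c_a t * (D_s(a) Theta_a(c_b t) D_s(a)^-1)]. *)
Lemma hatD_mul s a b : hatD DD s (a * b)%g = hatD DD s a + rep s a (hatD DD s b).
Proof.
rewrite !hatDE// /rep /Theta_rep -velocity_conj//; first last.
- by rewrite mulgV.
- by apply: sratio; exact: msmooth_curve.
rewrite -velocity_mulg1.
- congr velocity; apply/funext => t.
  by rewrite /at_time !DDM !(ThetaM TA) (ThetaV TA) invgM !mulgA mulgVK.
- by apply: sratio; exact: msmooth_curve.
- by apply: sconj; apply: sratio; exact: msmooth_curve.
- by rewrite mulgV.
- by rewrite mulgV (Theta1 TA) mulg1 mulgV.
Qed.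

(** With [h = D_s(a)] and [w t = tau t * (tau s)^-1], one has
    [D_t(a) h^-1 = w t * (h Theta_a((w t)^-1) h^-1)]. *)
Lemma hatD_gauge (tau : R^o -> H) (D : G -> H) s a : msmooth mR aH tau s ->
  (forall t, DD (a, t) = (tau t * D a * Theta a (tau t)^-1)%g) ->
  let v := velocity aH (fun t => (tau t * (tau s)^-1)%g) s in
  hatD DD s a = v - rep s a v.
Proof.
move=> st DE v; rewrite hatDE// /v /rep -Theta_repN -velocity_invg1; first last.
- by rewrite mulgV.
- exact: sratio.
rewrite /Theta_rep -velocity_conj//; first last.
- by rewrite mulgV invg1.
- by apply: msmooth_invg; exact: sratio.
rewrite -velocity_mulg1.
- congr velocity; apply/funext => t.
  rewrite /at_time !DE !invgM !invgK !(ThetaM TA) !(ThetaV TA) !invgK.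
  by rewrite !mulgA !mulgVK.
- exact: sratio.
- by apply: sconj; apply: msmooth_invg; exact: sratio.
- by rewrite mulgV.
- by rewrite mulgV invg1 (Theta1 TA) mulg1 mulgV.
Qed.

(** With [h = D_s(a)] and [w t = tau t * (tau s)^-1], the curve is
    [(tau s)^-1 * W t * (h Theta_a(tau s))], where
    [W t = (w t)^-1 * (D_t(a) h^-1 * (h Theta_a(w t) h^-1))] passes through the identity at
    [s] with velocity [k + (rep k - k) - rep k = 0]. *)
Lemma velocity_ungauge (tau : R^o -> H) (k : lie_alg H) s a : msmooth mR aH tau s ->
  velocity aH (fun t => (tau t * (tau s)^-1)%g) s = - k ->
  hatD DD s a = rep s a k - k ->
  velocity aH (fun t => ((tau t)^-1 * DD (a, t) * Theta a (tau t))%g) s = 0.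
Proof.
move=> st vt.
have ss := sratio s st.
have sc := sratio s (msmooth_curve sDD a s).
have s1 : (tau s * (tau s)^-1 = 1)%g by rewrite mulgV.
have c1 : (DD (a, s) * (DD (a, s))^-1 = 1)%g by rewrite mulgV.
pose h := DD (a, s); pose P := (tau s)^-1%g; pose Q := (h * Theta a (tau s))%g.
pose W t := ((tau t * (tau s)^-1)^-1 * ((DD (a, t) * h^-1) *
   (h * Theta a (tau t * (tau s)^-1) * h^-1)))%g.
rewrite hatDE// => hD.
have scj := sconj a h ss.
have sW : msmooth mR aH W s.
  by apply: msmooth_mulg; [exact: msmooth_invg|exact: msmooth_mulg].
have W0 : velocity aH W s = 0.
  rewrite velocity_mulg1;
    [|exact: msmooth_invg|exact: msmooth_mulg|by rewrite s1 invg1|]; last first.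
    by rewrite s1 c1 mul1g (Theta1 TA) mulg1 mulgV.
  rewrite velocity_mulg1//; last by rewrite s1 (Theta1 TA) mulg1 mulgV.
  rewrite velocity_invg1// velocity_conj// vt hD opprK.
  rewrite -[Ad _ _]/(rep s a (- k)) /rep Theta_repN.
  by rewrite addrC -addrA [_ + k]addrC addrA subrK subrr.
have sPQ x : msmooth aH aH (fun x : H => (P * x * Q)%g) x.
  apply: msmooth_mulg; last exact: msmooth_cst.
  by apply: msmooth_mulg; [exact: msmooth_cst|exact: msmooth_id].
transitivity (velocity aH ((fun x : H => (P * x * Q)%g) \o W) s).
  congr velocity; apply/funext => t; rewrite /= /W /P /Q /h.
  rewrite !invgM !invgK !(ThetaM TA) (ThetaV TA) !mulgA.
  by rewrite mulVg mul1g !mulgVK.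
by rewrite (velocity_comp sW (sPQ _)) W0 tangent0.
Qed.

End Main.

Theorem theorem3p6 (R : realType) (G H : lieGroupType R)
    (Theta : G -> H -> H) (D : G -> H) (DD : G * R^o -> H) :
  lie_action Theta ->
  crossed_hom Theta D ->
  deformation Theta D DD ->
  [/\ forall s : R, cocycle1 Theta (at_time DD s) (hatD DD s),
      trivial_on Theta D DD [set: R] ->
        vanish_smoothly Theta (at_time DD) (hatD DD) &
      vanish_smoothly Theta (at_time DD) (hatD DD) ->
        pointwise_trivial Theta D DD].
Proof.
move=> TA _ [sDD0 D0 DDc].
have sDD p : msmooth (prod_atlas (lie_atlas G) (model_atlas R^o)) (lie_atlas H) DD p.
  by have /smooth_onP h := sDD0; apply: h; [exact: openT|].
have DDM a b t : DD ((a * b)%g, t) = (DD (a, t) * Theta a (DD (b, t)))%g.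
  by have [_] := DDc t; exact.
split.
- move=> s; split; first exact: smooth_hatD.
  move=> a b; rewrite /d1 (hatD_mul TA sDD DDM) opprD addrA.
  by rewrite [X in X + _]addrAC subrr sub0r addNr.
- move=> [tau [stau tau0 tauE]].
  have st s : msmooth (model_atlas R^o) (lie_atlas H) tau s.
    by have /smooth_onP h := stau; apply: h; [exact: openT|].
  pose Psi (p : R^o * R^o) := (tau p.2 * (tau p.1)^-1)%g.
  pose v s := velocity (lie_atlas H) (fun t => Psi (s, t)) s.
  have sv s : msmooth (model_atlas R^o) (model_atlas (lie_alg H)) v s.
    apply: (@msmooth_velocity R _ _ _ _ (model_atlas R^o) (lie_atlas H) _ _ Psi id 1%g s) => [||r].
    + exact: msmooth_id.
    + apply: msmooth_mulg.
        by apply: msmooth_comp (st _); exact: msmooth_snd.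
      by apply: msmooth_invg; apply: msmooth_comp (st _); exact: msmooth_fst.
    + by rewrite /Psi mulgV.
  exists (fun s => (-1 : R^o) *: v s); split.
    apply/smooth_onP; first exact: openT.
    move=> s _; apply/msmooth_model; apply: smooth_atZ; first exact: smooth_at_cst.
    by apply/msmooth_model; exact: sv.
  move=> s; apply/funext => a; rewrite /d0 scaleN1r Theta_repN opprK addrC.
  by rewrite (hatD_gauge TA sDD (st s) (fun t => tauE a t I)).
- move=> [kap [skap kapE]].
  have sk t : smooth_at (fun t => - kap t) t.
    rewrite (_ : (fun t => _) = fun t => (-1 : R^o) *: kap t); last first.
      by apply/funext => s; rewrite scaleN1r.
    apply: smooth_atZ; first exact: smooth_at_cst.
    by apply/msmooth_model; have /smooth_onP h := skap; apply: h; [exact: openT|].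
  have [e [tau [e0 tau0 stau vtau]]] := right_ode sk.
  exists e, tau; split => //.
    apply/smooth_onP; first exact: interval_open.
    by move=> t; rewrite /= in_itv/=; exact: stau.
  move=> a.
  pose F t := ((tau t)^-1 * DD (a, t) * Theta a (tau t))%g.
  have sF t : - e < t < e -> msmooth (model_atlas R^o) (lie_atlas H) F t.
    move=> te; apply: msmooth_mulg.
      apply: msmooth_mulg; first by apply: msmooth_invg; exact: stau.
      exact: msmooth_curve.
    by apply: msmooth_comp (stau t te) _; exact: msmooth_Theta.
  have vF t : - e < t < e -> velocity (lie_atlas H) F t = 0.
    move=> te; apply: (velocity_ungauge TA sDD (stau t te) (vtau t te)).
    by rewrite -kapE.
  have [d [de Fd]] := velocity0_locally_cst e0 sF vF.
  exists d; split=> // t; rewrite /= in_itv/= => /Fd.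
  rewrite /F tau0 invg1 mul1g (Theta1 TA) mulg1 => Ft.
  rewrite -D0 /at_time -Ft (ThetaV TA) !mulgA mulgV mul1g.
  by rewrite mulgK.
Qed.
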